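(* The following is the computation result when we represent numbers with 40 decimal digits in the computation: for $g=2$, $$\widetilde{\mathrm{Area}}^{\,3}_{\max}\ \le\ 4\pi-4.96239\cdots\times 10^{-10},$$ where $\widetilde{\mathrm{Area}}^{\,3}_{\max}=\sup_{G\in A_2(3)}\mathrm{Area}^{\mathrm{cri}}(G)$.
   Context: $S_g$ denotes the closed orientable surface of genus $g$. A semiplanar graph $G=(V,E,F)$ is an undirected, locally finite, simple graph $(V,E)$ topologically embedded in a surface $S$, together with the set $F$ of faces (connected components of the complement of the image of the graph), which is a tessellation of $S$: (i) every face is homeomorphic to a disk whose boundary consists of finitely many edges of the graph; (ii) every edge is contained in exactly two different faces; (iii) whenever the closures of two faces intersect, the intersection is either a vertex or an edge. Moreover $\deg(x)\ge 3$ for every vertex $x$ and $\deg(\sigma)\ge 3$ for every face $\sigma$, where $\deg(x)$ is the number of neighbors of $x$ and $\deg(\sigma)$ is the number of edges (equivalently, vertices) incident to $\sigma$. All semiplanar graphs are finite. For $n\ge 3$, $a>0$, $\Delta_n(a)$ is the regular hyperbolic $n$-gon of side length $a$ in the hyperbolic plane $\mathbb{H}^2$ of curvature $-1$. The hyperbolic polyhedral surface $S_a^{\mathbb{H}^2}(G)$ is obtained by replacing each face $\sigma$ by $\Delta_{\deg(\sigma)}(a)$ and gluing along common edges. $\mathrm{Area}_a(G)$ is its area, $\theta_a(x)$ is the total angle at the vertex $x$ in $S_a^{\mathbb{H}^2}(G)$, and $K_a(x)=2\pi-\theta_a(x)$. $\mathcal{NC}_{\le -1}$ is the class of semiplanar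 graphs $G$ such that for some $a>0$ the space $S_a^{\mathbb{H}^2}(G)$ locally has curvature bounded above by $-1$ in the sense of Alexandrov (equivalently, as is well known, $K_a(x)\le 0$ for all $x\in V$). $\mathcal{NC}_{\le -1}^{g}$ is the set of finite $G\in\mathcal{NC}_{\le -1}$ embedded in $S_g$. For $G\in\mathcal{NC}_{\le -1}$: $a_c(x)=\max\{a>0: K_a(x)\le 0\}$ for $x\in V$, $a_c(G)=\min_{x\in V}a_c(x)$, and $\mathrm{Area}^{\mathrm{cri}}(G)=\mathrm{Area}_{a_c(G)}(G)$. $\mathcal{T}_{S_g}$ is the set of semiplanar graphs $G$ embedded in $S_g$ such that there is a tiling, with regular hyperbolic polygons, of $S_g$ equipped with a smooth hyperbolic metric, whose semiplanar graph structure is isomorphic to $G$. $A_g(N)=\{G=(V,E,F)\in\mathcal{NC}_{\le -1}^{g}\setminus\mathcal{T}_{S_g}:\ \deg(x)\le N\ \text{for all } x\in V\}$; thus $A_2(3)$ consists of graphs all of whose vertices have degree $3$. The computation referred to in the claim is the following. For a nondecreasing integer triple $p=(f_1,f_2,f_3)$ with $f_i\ge 3$ put $\Phi(p)=1-\sum_{i=1}^3\left(\frac12-\frac1{f_i}\right)$, $K_a(p)=2\pi-\sum_{i=1}^3 2\arcsin\frac{\cos(\pi/f_i)}{\cosh(a/2)}$ for $a>0$, and $a_c(p)=\max\{a>0: K_a(p)\le 0\}$. Let $B$ be the maximal face degree over all graphs in $\mathcal{NC}_{\le -1}^{2}$ all of whose vertices have degree $3$ (an integer between $16$ and $59$), and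 call $p$ admissible if $\Phi(p)<0$ and $f_3\le B$. Then $\mathrm{Area}^{\mathrm{cri}}(G)\le 4\pi+\kappa$ for all $G\in A_2(3)$, where $\kappa=\max\{K_{a_c(p)}(q): K_{a_c(p)}(q)<0,\ p,q\ \text{admissible},\ a_c(p)<a_c(q)\}$. The value of $\kappa$ was computed numerically (in Maple, with 40 decimal digits) for each possible value of $B$ in $[16,59]$; the largest value found is $\kappa=-4.96239\cdots\times 10^{-10}$, at $p=(29,55,55)$, $q=(32,43,55)$. The authors state that they do not know whether the algorithm with the 40 decimal digit representation of numbers is enough to confirm the value of $\kappa$. *)

(* Defs.v *)
From HB Require Import structures.
From mathcomp Require Import all_boot all_order all_algebra fingroup perm.
From mathcomp Require Import all_classical all_reals all_analysis.
Import Order.TTheory GRing.Theory Num.Theory.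
Import numFieldNormedType.Exports.

Set Implicit Arguments.
Unset Strict Implicit.
Unset Printing Implicit Defensive.


(* A finite graph cellularly embedded in a closed oriented surface is encoded *)
(* as a combinatorial map: the darts are the oriented edges, [edge] reverses  *)
(* a dart, and [node] sends a dart to the next one, in the cyclic order given *)
(* by the orientation, with the same initial vertex. Vertices, edges and      *)
(* faces are the orbits of [node], [edge] and [face]; the dart [face x] leaves*)
(* the vertex at which [x] arrives.                                           *)
Record cmap := CMap {
  dart :> finType;
  edge : {perm dart};
  node : {perm dart};
  edgeK : involutive edge;
  edge_neq : forall x : dart, edge x != x;
  dart_gt0 : (0 < #|dart|)%N;
  dart_connect : forall x y : dart,
    connect (relU (frel edge) (frel node)) x y }.

Section CombinatorialMap.
Variable G : cmap.
Local Open Scope set_scope.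
Implicit Types (v e s t : {set G}).

Definition face : {perm G} := (edge G * node G)%g.

Definition vertices : {set {set G}} := porbits (node G).
Definition edges : {set {set G}} := porbits (edge G).
Definition faces : {set {set G}} := porbits face.

Definition vertex_of (x : G) : {set G} := porbit (node G) x.
Definition edge_of (x : G) : {set G} := porbit (edge G) x.
Definition face_of (x : G) : {set G} := porbit face x.

Definition edge_ends e : {set {set G}} := [set vertex_of x | x in e].

Definition face_vertices s : {set {set G}} := [set vertex_of x | x in s].
Definition face_edges s : {set {set G}} := [set edge_of x | x in s].

Definition vertex_deg v : nat := #|[set vertex_of (edge G x) | x in v]|.
Definition face_deg s : nat := #|face_edges s|.

(* no loops and no multiple edges *)
Definition simple_graph : Prop :=
  (forall x : G, vertex_of x != vertex_of (edge G x)) /\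
  (forall x y : G, vertex_of x = vertex_of y ->
     vertex_of (edge G x) = vertex_of (edge G y) -> x = y).

(* The boundary of a face passes at most once through each vertex, that is,   *)
(* the closure of the face is a closed disk.                                  *)
Definition disk_faces : Prop :=
  forall s, s \in faces -> {in s &, injective vertex_of}.

Definition edges_two_faces : Prop :=
  forall x : G, face_of x != face_of (edge G x).

(* The closures of two distinct faces meet exactly in the vertices and edges  *)
(* incident to both of them.                                                  *)
Definition face_intersections : Prop :=
  forall s t, s \in faces -> t \in faces -> s != t ->
    let V := face_vertices s :&: face_vertices t in
    let E := face_edges s :&: face_edges t in
    V != finset.set0 ->
    (exists2 v, V = [set v] & E = finset.set0) \/
    (exists2 e, E = [set e] & V = edge_ends e).

Definition semiplanar : Prop :=
  [/\ simple_graph, disk_faces, edges_two_faces, face_intersections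
    & (forall v, v \in vertices -> (3 <= vertex_deg v)%N) /\
      (forall s, s \in faces -> (3 <= face_deg s)%N)].

(* #V - #E + #F = 2 - 2g *)
Definition has_genus (g : nat) : Prop :=
  (#|vertices| + #|faces| + g.*2 = #|edges| + 2)%N.

End CombinatorialMap.

Local Open Scope classical_set_scope.
Local Open Scope ring_scope.

(* The hyperbolic plane of curvature -1 in the hyperboloid model: the sheet   *)
(* z > 0 of x^2 + y^2 - z^2 = -1, with the Riemannian metric induced by the   *)
(* Lorentz form.                                                              *)
Section HyperbolicPlane.
Variable R : realType.
Implicit Types (p q u w : 'rV[R]_3) (r a phi : R) (n k : nat).

Definition cosh r : R := (expR r + expR (- r)) / 2.
Definition sinh r : R := (expR r - expR (- r)) / 2.

Definition lorentz p q : R :=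
  p 0 0 * q 0 0 + p 0 1 * q 0 1 - p 0 2 * q 0 2.

Definition hplane : set 'rV[R]_3 :=
  [set p | lorentz p p = -1 /\ 0 < p 0 2].

Definition hdist p q : R :=
  get [set d : R | 0 <= d /\ cosh d = - lorentz p q].

(* initial direction, in the tangent plane at p, of the geodesic from p to q  *)
Definition hdir p q : 'rV[R]_3 := q + lorentz p q *: p.

(* angle at p between the geodesics from p to q1 and from p to q2 *)
Definition hangle q1 p q2 : R :=
  let u := hdir p q1 in let w := hdir p q2 in
  acos (lorentz u w / (Num.sqrt (lorentz u u) * Num.sqrt (lorentz w w))).

(* the point with geodesic polar coordinates (r, phi) around (0, 0, 1) *)
Definition hpolar r phi : 'rV[R]_3 :=
  \row_(i < 3) [:: sinh r * cos phi; sinh r * sin phi; cosh r]`_i.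

(* In geodesic polar coordinates the metric is dr^2 + (sinh r)^2 dphi^2, so   *)
(* that the area element is sinh r dr dphi.                                   *)
Definition harea (A : set 'rV[R]_3) : \bar R :=
  let D : set (R * R) :=
    [set z | [/\ 0 <= z.1, 0 <= z.2 < 2 * pi & A (hpolar z.1 z.2)]] in
  (\int[lebesgue_measure \x lebesgue_measure]_(z in D) (sinh z.1)%:E)%E.

Definition polygon_vertex n r k : 'rV[R]_3 :=
  hpolar r (2 * pi * k%:R / n%:R).

Definition orient p q u : R := \det (\matrix_(i < 3) [:: p; q; u]`_i).

(* regular n-gon with circumradius r: the intersection of the half-planes to  *)
(* the left of the geodesics through consecutive vertices                     *)
Definition regular_polygon n r : set 'rV[R]_3 :=
  [set p | hplane p /\ forall k, (k < n)%N ->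
     0 <= orient (polygon_vertex n r k) (polygon_vertex n r k.+1) p].

(* circumradius of the regular n-gon with side length a *)
Definition circumradius n a : R :=
  get [set r : R | 0 < r /\
    hdist (polygon_vertex n r 0) (polygon_vertex n r 1) = a].

Definition polygon_angle n a : R :=
  let x := polygon_vertex n (circumradius n a) in hangle (x 0%N) (x 1%N) (x 2).

Definition polygon_area n a : R :=
  fine (harea (regular_polygon n (circumradius n a))).

End HyperbolicPlane.

Section HyperbolicPolyhedralSurface.
Variables (R : realType) (G : cmap).
Implicit Types (v s : {set G}) (a : R).

(* Every corner at v lies in the face of exactly one of the darts leaving v.  *)
Definition total_angle a v : R :=
  \sum_(x in v) polygon_angle (face_deg (face_of x)) a.

Definition curvature a v : R := 2 * pi - total_angle a v.

Definition surface_area a : R :=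
  \sum_(s in faces G) polygon_area (face_deg s) a.

Definition vertex_acrit v : R := sup [set a : R | 0 < a /\ curvature a v <= 0].

Definition acrit : R := inf [set vertex_acrit v | v in [set` vertices G]].

Definition area_cri : R := surface_area acrit.

Definition NC (g : nat) : Prop :=
  [/\ semiplanar G, has_genus G g &
      exists2 a : R, 0 < a &
        forall v, v \in vertices G -> curvature a v <= 0].

(* Regular hyperbolic polygons, with side lengths a priori depending on the   *)
(* face, are glued along edges of equal length; the resulting metric is       *)
(* smooth when the total angle at every vertex is 2 pi.                       *)
Definition hyperbolic_tiling (g : nat) : Prop :=
  [/\ semiplanar G, has_genus G g &
      exists side : {set G} -> R,
        [/\ forall s, s \in faces G -> 0 < side s,
            forall x : G, side (face_of x) = side (face_of (edge G x)) &
            forall v, v \in vertices G ->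
              \sum_(x in v)
                 polygon_angle (face_deg (face_of x)) (side (face_of x))
              = 2 * pi]].

End HyperbolicPolyhedralSurface.

Definition A_class (R : realType) (g N : nat) (G : cmap) : Prop :=
  [/\ NC R G g, ~ hyperbolic_tiling R G g &
    forall v : {set G}, v \in vertices G -> (vertex_deg v <= N)%N].

Definition sup_area_cri (R : realType) (g N : nat) : \bar R :=
  ereal_sup [set A | exists2 G : cmap, A_class R g N G & A = (area_cri R G)%:E].

(* K_a and a_c for a vertex pattern, i.e. the list f of the degrees of the    *)
(* faces around a vertex                                                      *)
Definition pattern_curvature (R : realType) (a : R) (f : seq nat) : R :=
  2 * pi - \sum_(n <- f) 2 * asin (cos (pi / n%:R) / cosh (a / 2)).

Definition pattern_acrit (R : realType) (f : seq nat) : R :=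
  sup [set a : R | 0 < a /\ pattern_curvature a f <= 0].

(* Main.v *)
(** By Gauss-Bonnet, Area_a(G) = 4 pi + sum_x K_a(x) in genus 2. At a = a_c(G)
    no K_a(x) is positive and some are 0; unless G comes from a tiling, some
    are negative, and by connectedness an edge joins a vertex p with K_a(p) = 0
    to a vertex q with K_a(q) < 0. Having degree 3, p and q have two faces in
    common, so K_a(q) = K_a(q) - K_a(p) is the difference between the angles
    of an m-gon and of an n-gon with m < n, which stays away from 0 as long as
    n is bounded. Now n <= 126, because the combinatorial curvatures Phi, all
    negative, have sum -2, and the vertices of an n-gonal face contribute at
    most 1 - n / 42. Hence Area_a(G) <= 4 pi - 10^-7, far below 4 pi + kappa:
    no enumeration of pairs of vertex patterns is needed.

    As to kappa, let b be half the angle of the 55-gon with side a_c(29,55,55).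
    The pattern (29,55,55) has curvature 0 when half the angle of the 29-gon is
    pi - 2 b, that is when cos b = cos(pi/29) / (2 cos(pi/55)); this makes
    sin(kappa/2) algebraic in the numbers cos(pi/n), which Taylor polynomials
    enclose between rationals. *)

Require Import Defs.
From Stdlib Require Import ZArith.
From Stdlib Require QArith_base.
From HB Require Import structures.
From mathcomp Require Import all_boot all_order all_algebra fingroup perm.
From mathcomp Require Import all_classical all_reals all_analysis.
From mathcomp Require Import measurable_realfun zify ssrZ ring lra.
Import Order.TTheory GRing.Theory Num.Theory.
Import numFieldNormedType.Exports.

Set Implicit Arguments.
Unset Strict Implicit.
Unset Printing Implicit Defensive.

Local Open Scope classical_set_scope.
Local Open Scope ring_scope.

(** * Regular hyperbolic polygons *)

Section Hyperbolic.
Variable R : realType.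
Implicit Types (x y r a : R).

Lemma ltr_asin : {in `[-1, 1] &, {mono (@asin R) : x y / x < y}}.
Proof.
move=> x y; rewrite !in_itv/= => hx hy.
have b (z : R) : -1 <= z <= 1 -> asin z \in `[- (pi / 2), pi / 2].
  by move=> hz; rewrite in_itv/= asin_geNpi2 ?asin_lepi2.
by rewrite -ltr_sin ?b// !asinK ?in_itv//=.
Qed.

Lemma asin0 : asin 0 = 0 :> R.
Proof. by rewrite -[X in asin X]sin0 sinK// in_itv/=; have := @pi_gt0 R; lra. Qed.

Lemma asin_ge0 x : 0 <= x <= 1 -> 0 <= asin x.
Proof.
move=> /andP[x0 x1]; rewrite leNgt -[X in _ < X]asin0 ltr_asin -?leNgt//.
all: by rewrite in_itv/=; lra.
Qed.

Lemma cosh2_sinh2 x : cosh x ^+ 2 - sinh x ^+ 2 = 1.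
Proof.
have h : expR x * expR (- x) = 1 by rewrite -expRD subrr expR0.
rewrite /cosh /sinh; move: (expR x) (expR (- x)) h => u v h.
have -> : ((u + v) / 2) ^+ 2 - ((u - v) / 2) ^+ 2 = u * v by field.
exact: h.
Qed.

Lemma cosh2E x : cosh x ^+ 2 = 1 + sinh x ^+ 2.
Proof. by rewrite -(cosh2_sinh2 x) subrK. Qed.

Lemma cosh_gt0 x : 0 < cosh x.
Proof. by rewrite divr_gt0// addr_gt0// expR_gt0. Qed.

Lemma cosh_ge1 x : 1 <= cosh x.
Proof.
rewrite -(@ler_pXn2r _ 2%N) ?nnegrE ?ler01 ?(ltW (cosh_gt0 _))//.
by rewrite expr1n cosh2E lerDl sqr_ge0.
Qed.

Lemma ltr_sinh : {mono (@sinh R) : x y / x < y}.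
Proof.
apply: leW_mono; apply: le_mono => x y xy.
by rewrite /sinh ltr_pM2r ?invr_gt0// ltrD// ?ltrN2 ltr_expR// ltrN2.
Qed.

Lemma sinh0 : sinh (0 : R) = 0.
Proof. by rewrite /sinh oppr0 subrr mul0r. Qed.

Lemma sinh_gt0 x : (0 < sinh x) = (0 < x).
Proof. by rewrite -{1}sinh0 ltr_sinh. Qed.

Lemma sinh_ge0 x : 0 <= x -> 0 <= sinh x.
Proof. by rewrite le_eqVlt => /orP[/eqP<-|h]; rewrite ?sinh0// ltW// sinh_gt0. Qed.

Lemma sinh_surj y : exists x, sinh x = y.
Proof.
have s2 : Num.sqrt (y ^+ 2 + 1) ^+ 2 = y ^+ 2 + 1.
  by rewrite sqr_sqrtr// addr_ge0// sqr_ge0.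
have s_gt : `|y| < Num.sqrt (y ^+ 2 + 1).
  by rewrite -sqrtr_sqr ltr_sqrt ?ltrDl// ltr_wpDl// sqr_ge0.
have p_gt0 : 0 < y + Num.sqrt (y ^+ 2 + 1).
  by move: s_gt; rewrite ltr_norml => /andP[]; lra.
(* This is the closed form of the inverse function; [y + sqrt (y ^ 2 + 1)] has the inverse
   [sqrt (y ^ 2 + 1) - y]. *)
exists (ln (y + Num.sqrt (y ^+ 2 + 1))).
rewrite /sinh expRN lnK ?posrE//.
move: (Num.sqrt _) s2 p_gt0 => s s2 p_gt0.
have -> : (y + s)^-1 = s - y.
  apply: (mulfI (lt0r_neq0 p_gt0)); rewrite divff ?lt0r_neq0//.
  have -> : (y + s) * (s - y) = s ^+ 2 - y ^+ 2 by ring.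
  by rewrite s2 addrAC subrr add0r.
by field.
Qed.

Lemma ltr_cosh x y : 0 <= x -> x < y -> cosh x < cosh y.
Proof.
move=> x0 xy; rewrite -(@ltr_pXn2r _ 2%N) ?nnegrE ?(ltW (cosh_gt0 _))//.
rewrite !cosh2E ltrD2l ltr_pXn2r// ?nnegrE ?ltr_sinh// sinh_ge0//.
exact: le_trans x0 (ltW xy).
Qed.

Lemma cosh_inj x y : 0 <= x -> 0 <= y -> cosh x = cosh y -> x = y.
Proof.
move=> x0 y0 h; case: (ltgtP x y) => // xy.
- by move: (ltr_cosh x0 xy); rewrite h ltxx.
- by move: (ltr_cosh y0 xy); rewrite h ltxx.
Qed.

Lemma cosh_surj y : 1 <= y -> exists2 x, 0 <= x & cosh x = y.
Proof.
move=> y1; have [x hx] := sinh_surj (Num.sqrt (y ^+ 2 - 1)).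
exists x.
  by rewrite leNgt -ltr_sinh sinh0 hx -leNgt sqrtr_ge0.
apply/eqP; rewrite -(@eqrXn2 _ 2%N)// ?(ltW (cosh_gt0 _))//; last lra.
rewrite cosh2E hx sqr_sqrtr ?subrKC//.
by rewrite subr_ge0 -[leLHS](expr1n _ 2) ler_pXn2r ?nnegrE//; lra.
Qed.

Lemma cosh_double x : cosh x = 1 + 2 * sinh (x / 2) ^+ 2.
Proof.
have e t : expR (t : R) = expR (t / 2) ^+ 2.
  by rewrite expr2 -expRD; congr expR; field.
have h : expR (x / 2) * expR (- (x / 2)) = 1 by rewrite -expRD subrr expR0.
rewrite /cosh /sinh (e x) (e (- x)) mulNr.
move: (expR (x / 2)) (expR (- (x / 2))) h => u v h.
apply: subr0_eq; have -> : (u ^+ 2 + v ^+ 2) / 2 -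
  (1 + 2 * ((u - v) / 2) ^+ 2) = u * v - 1 by field.
by rewrite h subrr.
Qed.

(** [hdist] is a choice by [get], which is meaningful once some distance exists; the surjectivity of
    cosh onto values at least 1 provides one, and its injectivity on nonnegative reals makes it
    unique. *)
Lemma hdistP (p q : 'rV[R]_3) a : 0 <= a -> 1 <= - lorentz p q ->
  hdist p q = a <-> cosh a = - lorentz p q.
Proof.
move=> a0 h1; have [d d0 hd] := cosh_surj h1.
have := @getPex _ [set d : R | 0 <= d /\ cosh d = - lorentz p q]
  (ex_intro _ d (conj d0 hd)).
rewrite -/(hdist p q) => -[h0 <-]; split => [->//|].
by move=> /cosh_inj ->.
Qed.

Lemma hpolarE r x : (hpolar r x 0 0 = sinh r * cos x) *
  (hpolar r x 0 1 = sinh r * sin x) * (hpolar r x 0 2 = cosh r).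
Proof. by rewrite /hpolar !mxE. Qed.

(** The half-angle form matches [cosh_double]: two points at distance d on a circle of radius r
    satisfy sinh (d / 2) = sinh r * |sin ((x - y) / 2)|. *)
Lemma lorentz_hpolar r x y :
  lorentz (hpolar r x) (hpolar r y) = - (1 + 2 * (sinh r * sin ((x - y) / 2)) ^+ 2).
Proof.
have c : cos (x - y) = 1 - 2 * sin ((x - y) / 2) ^+ 2.
  have {1}-> : x - y = ((x - y) / 2) *+ 2 by rewrite -mulr_natr; field.
  by rewrite cos_mulr2n cos2sin2 -mulr_natr; ring.
have -> : lorentz (hpolar r x) (hpolar r y) =
    sinh r ^+ 2 * cos (x - y) - cosh r ^+ 2.
  by rewrite /lorentz !hpolarE cosB; ring.
by rewrite c cosh2E; ring.
Qed.

Lemma lorentz_polygon_vertex n r k l :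
  lorentz (polygon_vertex n r k) (polygon_vertex n r l) =
  - (1 + 2 * (sinh r * sin (pi * (k%:R - l%:R) / n%:R)) ^+ 2).
Proof.
rewrite lorentz_hpolar; congr (- (1 + 2 * (_ * sin _) ^+ 2)).
by move: (n%:R^-1) => t; field.
Qed.

Lemma orient_hpolar r x y z rho :
  orient (hpolar r x) (hpolar r y) (hpolar rho z) =
  cosh rho * sinh r ^+ 2 * sin (y - x) +
  cosh r * sinh r * sinh rho * (sin (z - y) - sin (z - x)).
Proof.
rewrite /orient (expand_det_row _ ord0) !big_ord_recl big_ord0 /cofactor.
rewrite !(expand_det_row _ ord0) !big_ord_recl !big_ord0 /cofactor.
rewrite !det_mx11 !mxE/=.
rewrite /bump/= !addn0 !add0n !sinB; ring.
Qed.

Section RegularPolygon.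
Variables (n : nat) (a : R).
Hypotheses (n_ge3 : (3 <= n)%N) (a_gt0 : 0 < a).

Let n_gt0 : 0 < n%:R :> R.
Proof. by rewrite ltr0n (leq_trans _ n_ge3). Qed.

Lemma pidivn_bounds : 0 < (pi : R) / n%:R <= pi / 3.
Proof.
rewrite divr_gt0 ?pi_gt0//= ler_pM2l ?pi_gt0// lef_pV2 ?posrE//.
by rewrite ler_nat.
Qed.

Lemma sin_pidivn_gt0 : 0 < sin ((pi : R) / n%:R).
Proof.
have := pidivn_bounds; have := @pi_gt0 R => ? ?.
by apply: sin_gt0_pi; lra.
Qed.

Lemma cos_pidivn_gt0 : 0 < cos ((pi : R) / n%:R).
Proof.
have := pidivn_bounds; have := @pi_gt0 R => ? ?.
by apply: cos_gt0_pihalf; lra.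
Qed.

(** The equation is the law of sines in the right triangle formed by the centre, a vertex and the
    midpoint of a side. It has a positive solution, so the [get] in [circumradius] does not fall
    back on a default value. *)
Lemma circumradiusP : 0 < circumradius n a /\
  sinh (circumradius n a) * sin (pi / n%:R) = sinh (a / 2).
Proof.
have a2 : 0 <= a / 2 by rewrite divr_ge0 ?ltW.
have key r : 0 < r -> (hdist (polygon_vertex n r 0) (polygon_vertex n r 1) = a
    <-> sinh r * sin (pi / n%:R) = sinh (a / 2)).
  move=> r0; rewrite hdistP; try exact: ltW; rewrite lorentz_polygon_vertex opprK; last first.
    by rewrite lerDl mulr_ge0// sqr_ge0.
  rewrite sub0r mulrN1 mulNr sinN mulrN sqrrN cosh_double.
  split=> [|->//].
  have two_neq0 : 2 != 0 :> R by rewrite pnatr_eq0.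
  move=> /addrI/(mulfI two_neq0) h.
  apply/esym/eqP; rewrite -(@eqrXn2 _ 2%N) ?h ?sinh_ge0//.
  by rewrite mulr_ge0 ?sinh_ge0 ?(ltW r0)// ltW// sin_pidivn_gt0.
have ex : exists r, 0 < r /\
    hdist (polygon_vertex n r 0) (polygon_vertex n r 1) = a.
  have [r hr] := sinh_surj (sinh (a / 2) / sin (pi / n%:R)).
  have r0 : 0 < r.
    rewrite -sinh_gt0 hr divr_gt0 ?sin_pidivn_gt0// sinh_gt0.
    by rewrite divr_gt0.
  by exists r; split=> //; apply/key => //; rewrite hr divfK ?gt_eqF ?sin_pidivn_gt0.
have [r0 /key h] := @getPex _ [set r : R | 0 < r /\
    hdist (polygon_vertex n r 0) (polygon_vertex n r 1) = a] ex.
by split=> //; exact: h.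
Qed.

(** In the same right triangle, cos (pi / n) = cosh (a / 2) * sin (angle / 2). The proof obtains
    this from the Lorentz products of three consecutive vertices. *)
Lemma polygon_angleE : polygon_angle n a =
  2 * asin (cos (pi / n%:R) / cosh (a / 2)).
Proof.
have [r0 hr] := circumradiusP.
rewrite /polygon_angle; move: (circumradius n a) r0 hr => r r0 hr.
set x := polygon_vertex n r.
set S := sinh (a / 2); have S0 : 0 < S by rewrite sinh_gt0 divr_gt0.
set C := cos (pi / n%:R); have C0 : 0 < C by exact: cos_pidivn_gt0.
have x00 : lorentz (x 0%N) (x 0%N) = -1.
  by rewrite lorentz_polygon_vertex subrr mulr0 mul0r sin0 mulr0 expr0n mulr0 addr0.
have x11 : lorentz (x 1%N) (x 1%N) = -1.
  by rewrite lorentz_polygon_vertex subrr mulr0 mul0r sin0 mulr0 expr0n mulr0 addr0.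
have x22 : lorentz (x 2%N) (x 2%N) = -1.
  by rewrite lorentz_polygon_vertex subrr mulr0 mul0r sin0 mulr0 expr0n mulr0 addr0.
have x10 : lorentz (x 1%N) (x 0%N) = - (1 + 2 * S ^+ 2).
  by rewrite lorentz_polygon_vertex subr0 mulr1 hr.
have x12 : lorentz (x 1%N) (x 2%N) = - (1 + 2 * S ^+ 2).
  rewrite lorentz_polygon_vertex [1%:R - _](_ : _ = -1) ?mulrN1 ?mulNr ?sinN ?mulrN ?sqrrN ?hr//.
  by ring.
have x02 : lorentz (x 0%N) (x 2%N) = - (1 + 8 * (S * C) ^+ 2).
  rewrite lorentz_polygon_vertex.
  have -> : pi * (0%:R - 2%:R) / n%:R = - (pi / n%:R *+ 2) :> R.
    by rewrite -mulr_natr; move: (n%:R^-1) => t; ring.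
  rewrite sinN sin_mulr2n -/C -[_ *+ 2]mulr_natr /S -hr; ring.
(* [hdir p] is the Lorentz-orthogonal projection onto the tangent plane at p, which adds one
   correction term to the product. *)
have bil (p u w : 'rV[R]_3) : lorentz p p = -1 ->
    lorentz (hdir p u) (hdir p w) = lorentz u w + lorentz p u * lorentz p w.
  move=> hp; have -> : lorentz (hdir p u) (hdir p w) = lorentz u w +
      lorentz p u * lorentz p w * (2 + lorentz p p).
    by rewrite /hdir /lorentz !mxE; ring.
  by rewrite hp; ring.
rewrite /hangle !bil// x00 x22 x10 x12 x02.
have -> : -1 + - (1 + 2 * S ^+ 2) * - (1 + 2 * S ^+ 2) = 4 * S ^+ 2 * (1 + S ^+ 2).
  by ring.
have S2 : 0 < S ^+ 2 by rewrite exprn_gt0.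
rewrite -[Num.sqrt _ * _]expr2 sqr_sqrtr; last first.
  by apply/ltW; do ?apply: mulr_gt0 => //; apply: addr_gt0.
set z := C / cosh (a / 2).
have ch0 := cosh_gt0 (a / 2).
have z2 : z ^+ 2 = C ^+ 2 / (1 + S ^+ 2) by rewrite expr_div_n cosh2E.
have -> : (- (1 + 8 * (S * C) ^+ 2) + - (1 + 2 * S ^+ 2) * - (1 + 2 * S ^+ 2)) /
   (4 * S ^+ 2 * (1 + S ^+ 2)) = 1 - 2 * z ^+ 2.
  rewrite z2; field; rewrite !gt_eqF ?addr_gt0//.
have z0 : 0 < z by rewrite divr_gt0.
have z1 : z <= 1.
  by rewrite ler_pdivrMr// mul1r (le_trans (cos_le1 _))// cosh_ge1.
have zi : z \in `[-1, 1] by rewrite in_itv/= z1 andbT; lra.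
(* The cosine of the angle is 1 - 2 sin ^ 2 of its half, and [2 * asin z] lies in [0, pi], where
   [acos] inverts [cos]. *)
have -> : 1 - 2 * z ^+ 2 = cos (2 * asin z).
  rewrite [in RHS]mulr_natl cos_mulr2n cos2sin2 asinK// -mulr_natr; ring.
have [? ?] : 0 <= asin z /\ asin z <= pi / 2.
  split; last by apply: asin_lepi2; move: zi; rewrite in_itv.
  by rewrite asin_ge0// ltW.
by rewrite cosK// in_itv/=; lra.
Qed.

End RegularPolygon.

End Hyperbolic.

(** * Derivatives of the hyperbolic functions and integration by antiderivatives *)

Section Calculus.
Variable R : realType.
Implicit Types (x y a b : R) (f F : R -> R).

Lemma cosh0 : cosh (0 : R) = 1.
Proof. by rewrite /cosh oppr0 expR0; field. Qed.

Lemma asinN x : -1 <= x <= 1 -> asin (- x) = - asin x.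
Proof.
move=> hx; apply: (@sin_inj R).
- by rewrite in_itv/= asin_geNpi2 ?asin_lepi2//; lra.
- rewrite in_itv/= lerN2 asin_lepi2//= lerNl asin_geNpi2//.
- by rewrite sinN !asinK// in_itv/=; lra.
Qed.

Lemma is_derive_cosh x : is_derive x 1 (@cosh R) (sinh x).
Proof.
rewrite (_ : @cosh R = (2^-1 : R) \*: (expR + (expR \o -%R))); last first.
  by apply/funext => r; rewrite /cosh /= mulrC.
apply: is_derive_eq.
by rewrite /sinh /GRing.scale /=; field.
Qed.

Lemma is_derive_sinh x : is_derive x 1 (@sinh R) (cosh x).
Proof.
rewrite (_ : @sinh R = (2^-1 : R) \*: (expR - (expR \o -%R))); last first.
  by apply/funext => r; rewrite /sinh /= mulrC.
apply: is_derive_eq.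
by rewrite /cosh /GRing.scale /=; field.
Qed.

Lemma is_derive_continuous f x a : is_derive x 1 f a -> {for x, continuous f}.
Proof. by move=> [/derivable1_diffP/differentiable_continuous]. Qed.

Lemma continuous_cosh : continuous (@cosh R).
Proof. by move=> x; apply: is_derive_continuous (is_derive_cosh x). Qed.

Lemma continuous_sinh : continuous (@sinh R).
Proof. by move=> x; apply: is_derive_continuous (is_derive_sinh x). Qed.

Lemma integral_is_derive f F a b : a < b ->
  (forall x, a <= x <= b -> is_derive x 1 F (f x)) ->
  {within `[a, b], continuous f} ->
  (\int[lebesgue_measure]_(x in `[a, b]) (f x)%:E = (F b - F a)%:E)%E.
Proof.
move=> ab dF cf; rewrite EFinB; apply: continuous_FTC2 => //.
- split=> [x||].
  + by rewrite in_itv/= => /andP[ax xb]; have [] := dF x; rewrite ?ltW.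
  + apply: cvg_at_right_filter; apply: is_derive_continuous (dF a _).
    by rewrite lexx ltW.
  + apply: cvg_at_left_filter; apply: is_derive_continuous (dF b _).
    by rewrite lexx ltW.
- move=> x; rewrite in_itv/= => /andP[ax xb]; rewrite derive1E.
  by have [] := dF x; rewrite ?ltW.
Qed.

End Calculus.

Section IntegralMonotone.
Local Open Scope ereal_scope.
Context d (T : measurableType d) (R : realType).
Variable mu : {measure set T -> \bar R}.

(** The integral of a nonnegative function is a supremum over the simple functions below it, and a
    larger function has more of them. *)
Lemma le_integral_nonmeasurable (f g : T -> \bar R) :
  (forall x, 0 <= f x) -> (forall x, f x <= g x) ->
  \int[mu]_x f x <= \int[mu]_x g x.
Proof.
move=> f0 fg; have g0 x : 0 <= g x by exact: le_trans (f0 x) (fg x).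
rewrite !ge0_integralTE//; apply: ereal_sup_le.
by move=> _ [h hf <-]; exists h => // x; apply: le_trans (hf x) (fg x).
Qed.

End IntegralMonotone.

(** * Area of the triangle spanned by the centre and one side, in polar coordinates *)

Section Sector.
Variables (R : realType) (t h m : R).
Hypotheses (t_gt0 : 0 < t) (h_gt0 : 0 < h) (h_lt : h < pi / 2)
  (t_lt : t < cos h).

(* The side of the polygon is the curve tanh rho * cos (y - m) = t in polar
   coordinates (rho, y), and [g y] is cosh rho there. *)
Let g (y : R) := cos (y - m) / Num.sqrt (cos (y - m) ^+ 2 - t ^+ 2).

Let cosh_le y : m - h <= y <= m + h -> cos h <= cos (y - m).
Proof.
move=> hy; have -> : cos (y - m) = cos `|y - m| by rewrite cos_norm.
have ph := h_lt; have pp := @pi_gt0 R; have h0 := h_gt0.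
have yh : `|y - m| <= h by rewrite ler_norml; lra.
rewrite leNgt ltr_cos -?leNgt// in_itv/= ?normr_ge0/=; lra.
Qed.

Let t_lt_cos y : m - h <= y <= m + h -> t < cos (y - m).
Proof. by move=> /cosh_le; exact: lt_le_trans. Qed.

Let radicand_gt0 y : m - h <= y <= m + h -> 0 < cos (y - m) ^+ 2 - t ^+ 2.
Proof.
move=> /t_lt_cos ty; rewrite subr_gt0 ltr_pXn2r// ?nnegrE ?ltW//.
exact: lt_trans ty.
Qed.

Let t_lt1 : 0 < 1 - t ^+ 2.
Proof.
rewrite subr_gt0 expr_lt1 ?ltW//.
exact: lt_le_trans t_lt (cos_le1 h).
Qed.

Let g_gt1 y : m - h <= y <= m + h -> 1 < g y.
Proof.
move=> hy; have r0 := radicand_gt0 hy; have ty := t_lt_cos hy.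
have c0 : 0 < cos (y - m) by exact: lt_trans ty.
rewrite /g ltr_pdivlMr ?sqrtr_gt0// mul1r.
rewrite -[ltRHS]ger0_norm ?ltW// -sqrtr_sqr ltr_sqrt ?exprn_gt0//.
by rewrite ltrBlDr ltrDl exprn_gt0.
Qed.

Let g_cont : {within `[m - h, m + h], continuous (fun y => g y - 1)}.
Proof.
apply: continuous_in_subspaceT => y; rewrite inE/= in_itv/= => hy.
have cc : {for y, continuous (fun z => cos (z - m) : R)}.
  apply: (@continuous_comp _ _ _ (fun z : R => z - m) (@cos R)).
    by apply: cvgB; [exact: cvg_id|exact: cvg_cst].
  exact: continuous_cos.
apply: cvgB; last exact: cvg_cst.
apply: cvgM => //; apply: cvgV.
  by rewrite sqrtr_eq0 -ltNge radicand_gt0.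
apply: (@continuous_comp _ _ _ (fun z : R => cos (z - m) ^+ 2 - t ^+ 2) Num.sqrt);
  last exact: sqrt_continuous.
apply: cvgB; last exact: cvg_cst.
exact: (@continuous_comp _ _ _ (fun z : R => cos (z - m)) (fun z => z ^+ 2) y cc
  (@exprn_continuous _ _ _)).
Qed.

Let q := Num.sqrt (1 - t ^+ 2).

Let sin_q_bounds y : m - h <= y <= m + h -> -1 < sin (y - m) / q < 1.
Proof.
move=> hy; have r0 := radicand_gt0 hy.
have q0 : 0 < q by rewrite sqrtr_gt0.
have q2 : q ^+ 2 = 1 - t ^+ 2 by rewrite sqr_sqrtr// ltW.
have su : (sin (y - m) / q) ^+ 2 < 1.
  rewrite expr_div_n q2 ltr_pdivrMr// mul1r sin2cos2.
  by rewrite ltrD2l ltrN2 -subr_gt0.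
by rewrite -ltr_norml -(@ltr_pXn2r _ 2%N)// ?nnegrE// -normrX ger0_norm ?sqr_ge0// expr1n.
Qed.

(** Since cos ^ 2 - t ^ 2 = q ^ 2 - sin ^ 2, the function [g] is the derivative of the arcsine of
    sin (y - m) / q. *)
Let F_deriv y : m - h <= y <= m + h ->
  is_derive y 1 (fun y => asin (sin (y - m) / q) - y : R) (g y - 1).
Proof.
move=> hy; have q0 : 0 < q by rewrite sqrtr_gt0.
have r0 := radicand_gt0 hy.
have q2 : q ^+ 2 = 1 - t ^+ 2 by rewrite sqr_sqrtr// ltW.
have hu := sin_q_bounds hy.
have d1 : is_derive y 1 (fun z : R => z - m) 1.
  by apply: is_derive_eq; rewrite subr0.
have d2 : is_derive y 1 (fun z : R => sin (z - m)) (cos (y - m)).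
  rewrite -[X in is_derive _ _ _ X]mulr1.
  exact: (@is_derive1_comp _ (@sin R) (fun z => z - m)).
have d3 : is_derive y 1 (fun z : R => sin (z - m) / q) (cos (y - m) / q).
  rewrite (_ : (fun z => _) = q^-1 \*: (fun z : R => sin (z - m))); last first.
    by apply/funext => z; rewrite /= mulrC.
  by apply: is_derive_eq; rewrite /GRing.scale/= mulrC.
have d4 := @is_derive1_comp _ (@asin R) _ y _ _ (is_derive1_asin hu) d3.
have -> : g y - 1 = (Num.sqrt (1 - (sin (y - m) / q) ^+ 2))^-1 * (cos (y - m) / q) - 1.
  rewrite /g (_ : cos (y - m) ^+ 2 - t ^+ 2 = q ^+ 2 * (1 - (sin (y - m) / q) ^+ 2)).
    rewrite sqrtrM ?sqr_ge0// sqrtr_sqr ger0_norm ?ltW// invfM.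
    by rewrite mulrA mulrC.
  by rewrite mulrBr expr_div_n mulrCA divff ?gt_eqF ?exprn_gt0// q2 sin2cos2; ring.
rewrite (_ : (fun z => _) = (asin \o (fun z : R => sin (z - m) / q)) - id)//.
exact: is_deriveB.
Qed.

(** The last condition says tanh rho * cos (phi - m) <= t: the point lies on the same side of the
    polygon side as the centre. *)
Let E : set (R * R) := [set z | [/\ 0 <= z.1, m - h <= z.2 <= m + h &
  sinh z.1 * cos (z.2 - m) <= t * cosh z.1]].

Lemma measurable_sector : measurable E.
Proof.
have -> : E = [set z | 0 <= z.1] `&` [set z | m - h <= z.2] `&`
    [set z | z.2 <= m + h] `&`
    [set z | sinh z.1 * cos (z.2 - m) <= t * cosh z.1].
  apply/seteqP; split=> z; rewrite /E/=.
    by case=> ? /andP[? ?] ?.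
  by case=> -[[? ?] ?] ?; split=> //; apply/andP.
have meas (f1 f2 : R * R -> R) : measurable_fun setT f1 ->
    measurable_fun setT f2 -> measurable [set z | f1 z <= f2 z].
  move=> mf1 mf2; rewrite -[X in measurable X]setTI.
  have := measurable_fun_ler mf1 mf2 measurableT (Y := [set true]).
  by apply.
have m1 : measurable_fun [set: R * R] (fun z => z.1) by exact: measurable_fst.
have m2 : measurable_fun [set: R * R] (fun z => z.2) by exact: measurable_snd.
have mc (f1 : R -> R) (f2 : R * R -> R) : continuous f1 -> measurable_fun setT f2 ->
    measurable_fun setT (f1 \o f2).
  move=> cf mf; apply: measurableT_comp => //.
  exact: continuous_measurable_fun.
do ?apply: measurableI; apply: meas => //.
- apply: measurable_funM; first exact: mc (@continuous_sinh R) m1.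
  apply: (mc (@cos R)); first exact: continuous_cos.
  exact: measurable_funB.
- by apply: measurable_funM => //; exact: mc (@continuous_cosh R) m1.
Qed.

Lemma integral_sector_le :
  (\int[lebesgue_measure \x lebesgue_measure]_z
     (((fun z : R * R => (sinh z.1)%:E) \_ E) z)
   <= (2 * asin (sin h / q) - 2 * h)%:E)%E.
Proof.
have E1 z : E z -> 0 <= z.1 by case.
pose f z := (((fun z : R * R => (sinh z.1)%:E) \_ E) z).
have f0 z : (0 <= f z)%E.
  rewrite /f /patch; case: ifPn => // /[!inE]/E1 z1.
  by rewrite lee_fin sinh_ge0.
have mf : measurable_fun setT f.
  apply/(measurable_restrictT _ _).1 => //; first exact: measurable_sector.
  apply: measurable_funTS; apply/measurable_EFinP.
  apply: (@measurableT_comp _ _ _ _ _ _ (@sinh R)); last exact: measurable_fst.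
  by apply: continuous_measurable_fun; exact: continuous_sinh.
(* Tonelli, with the radius integrated first: along a ray the integral of sinh is at most [g y - 1],
   and it vanishes outside the angular range. *)
rewrite [leLHS](_ : _ =
    (\int[lebesgue_measure]_y fubini_G lebesgue_measure f y)%E); last first.
  exact: (@fubini_tonelli2 _ _ _ _ R lebesgue_measure lebesgue_measure f mf f0).
pose I : set R := `[m - h, m + h]%classic.
have inner y : (fubini_G lebesgue_measure f y <=
    ((fun y => (g y - 1)%:E) \_ I) y)%E.
  rewrite /fubini_G [leRHS]/patch /I; case: ifPn => hy; last first.
    rewrite integral0_eq// => x _; rewrite /f /patch.
    case: ifPn => // /[!inE]-[_ h1 _].
    by move: hy; rewrite notin_setE/= in_itv/= h1 => /(_ isT).
  move: hy; rewrite inE/= in_itv/= => hy.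
  have g1 := g_gt1 hy; have r0 := radicand_gt0 hy.
  (* [b] is the radius at which the ray meets the side. *)
  have [b b0 hb] := cosh_surj (ltW g1).
  have {}b0 : 0 < b.
    rewrite lt_neqAle b0 andbT; apply/eqP => b00.
    by move: g1; rewrite -hb -b00 cosh0 ltxx.
  have := @integral_is_derive R (@sinh R) (@cosh R) 0 b b0
    (fun x _ => is_derive_cosh x) (continuous_subspaceT (@continuous_sinh R)).
  rewrite hb => hI.
  have -> : (g y - 1)%:E = (g y - cosh 0)%:E :> \bar R.
    by rewrite cosh0.
  rewrite -hI [leRHS]integral_mkcond; apply: le_integral_nonmeasurable => // x.
  rewrite /f /patch; case: ifPn => [|_]; last first.
    by case: ifPn => // /[!inE]/=; rewrite in_itv/= => /andP[x0 _]; rewrite lee_fin sinh_ge0.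
  rewrite inE => -[/= x0 _ hx].
  rewrite ifT// inE/= in_itv/= x0/= leNgt; apply/negP => bx.
  have c0 : 0 < cos (y - m) by exact: lt_trans (t_lt_cos hy).
  (* Squaring the condition of the sector and replacing sinh ^ 2 by cosh ^ 2 - 1 gives cosh ^ 2 *
     (cos ^ 2 - t ^ 2) <= cos ^ 2. *)
  have : cosh x <= g y.
    rewrite /g ler_pdivlMr ?sqrtr_gt0//.
    rewrite -(@ler_pXn2r _ 2%N) ?nnegrE ?mulr_ge0 ?sqrtr_ge0 ?(ltW c0) ?(ltW (cosh_gt0 _))//.
    rewrite exprMn sqr_sqrtr ?(ltW r0)//.
    have : (sinh x * cos (y - m)) ^+ 2 <= (t * cosh x) ^+ 2.
      rewrite ler_pXn2r// nnegrE mulr_ge0 ?sinh_ge0 ?(ltW c0) ?(ltW t_gt0) ?(ltW (cosh_gt0 _))//.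
    have e : cos (y - m) ^+ 2 = cosh x ^+ 2 * cos (y - m) ^+ 2 -
        sinh x ^+ 2 * cos (y - m) ^+ 2 by rewrite -mulrBl cosh2_sinh2 mul1r.
    rewrite (exprMn 2 (sinh x)) (exprMn 2 t) => hle.
    rewrite mulrBr [leRHS]e; lra.
  by rewrite -hb leNgt ltr_cosh// ltW.
apply: (@le_trans _ _ (\int[lebesgue_measure]_(y in I)
    (g y - 1)%:E)%E).
  rewrite [leRHS]integral_mkcond.
  apply: le_integral_nonmeasurable => // y.
  by apply: integral_ge0 => x _; exact: f0.
have lt_h : m - h < m + h by have h0 := h_gt0; lra.
have -> := integral_is_derive lt_h F_deriv g_cont.
rewrite lee_fin.
have -> : m + h - m = h by ring.
have -> : m - h - m = - h by ring.
rewrite sinN mulNr asinN.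
  lra.
have := sin_q_bounds (y := m + h); rewrite (_ : m + h - m = h); last by ring.
by rewrite lexx ltW// => /(_ isT)/andP[/ltW-> /ltW->].
Qed.

End Sector.

(** * Taylor polynomials of sine and cosine as alternating bounds *)

Section Taylor.
Variable R : realType.
Implicit Types (x y : R) (n k : nat).

Lemma ge0_is_derive_ge0 (f df : R -> R) x : 0 <= x -> f 0 = 0 ->
  (forall y, is_derive y 1 f (df y)) -> (forall y, 0 <= y -> 0 <= df y) -> 0 <= f x.
Proof.
move=> x0 f00 fd df0.
have [|c] := @MVT_segment R f df 0 x x0 (fun y _ => fd y).
  by apply: continuous_subspaceT => y; exact: is_derive_continuous (fd y).
rewrite in_itv/= f00 !subr0 => /andP[c0 _] ->.
by rewrite mulr_ge0// df0.
Qed.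

Definition cos_partial n x : R := \sum_(k < n) (-1) ^+ k * (x ^+ k.*2 / k.*2`!%:R).
Definition sin_partial n x : R := \sum_(k < n) (-1) ^+ k * (x ^+ k.*2.+1 / k.*2.+1`!%:R).

Lemma is_derive_pow_fact k x :
  is_derive x 1 (fun y => y ^+ k.+1 / k.+1`!%:R : R) (x ^+ k / k`!%:R).
Proof.
rewrite (_ : (fun y : R => _) = (k.+1`!%:R^-1 : R) \*: ((@idfun R) ^+ k.+1)); last first.
  by apply/funext => y; rewrite /= exprfctE mulrC.
apply: is_derive_eq; rewrite /GRing.scale/= mulr1 factS natrM.
have h1 : k.+1%:R != 0 :> R by rewrite pnatr_eq0.
have h2 : k`!%:R != 0 :> R by rewrite pnatr_eq0 -lt0n fact_gt0.
move: (k.+1%:R : R) (k`!%:R : R) h1 h2 => u v h1 h2.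
by field; rewrite h1 h2.
Qed.

Lemma sin_partialS n x : sin_partial n.+1 x =
  sin_partial n x + (-1) ^+ n * (x ^+ n.*2.+1 / n.*2.+1`!%:R).
Proof. by rewrite /sin_partial big_ord_recr. Qed.

Lemma cos_partialS n x : cos_partial n.+1 x =
  cos_partial n x + (-1) ^+ n * (x ^+ n.*2 / n.*2`!%:R).
Proof. by rewrite /cos_partial big_ord_recr. Qed.

Lemma is_derive_sin_partial n x : is_derive x 1 (sin_partial n) (cos_partial n x).
Proof.
elim: n => [|n IHn].
  rewrite (_ : sin_partial 0 = cst 0); last by apply/funext => y; rewrite /sin_partial big_ord0.
  by rewrite /cos_partial big_ord0; exact: is_derive_cst.
have d := is_derive_pow_fact n.*2 x.
rewrite (_ : sin_partial n.+1 = sin_partial n +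
    ((-1) ^+ n : R) \*: (fun y : R => y ^+ n.*2.+1 / n.*2.+1`!%:R)); last first.
  by apply/funext => y; rewrite sin_partialS.
by rewrite cos_partialS; apply: is_derive_eq.
Qed.

Lemma is_derive_cos_partial n x :
  is_derive x 1 (cos_partial n.+1) (- sin_partial n x).
Proof.
elim: n => [|n IHn].
  rewrite (_ : cos_partial 1 = cst 1); last first.
    by apply/funext => y; rewrite /cos_partial big_ord1 expr0 mul1r divr1.
  by rewrite /sin_partial big_ord0 oppr0; exact: is_derive_cst.
have d := is_derive_pow_fact n.*2.+1 x.
rewrite (_ : cos_partial n.+2 = cos_partial n.+1 +
    ((-1) ^+ n.+1 : R) \*: (fun y : R => y ^+ n.*2.+2 / n.*2.+2`!%:R)); last first.
  by apply/funext => y; rewrite cos_partialS.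
by rewrite sin_partialS; apply: is_derive_eq; rewrite exprS /GRing.scale/=; ring.
Qed.

Lemma sin_partial0 n : sin_partial n 0 = 0.
Proof. by rewrite /sin_partial big1// => k _; rewrite expr0n/= mul0r mulr0. Qed.

Lemma cos_partial0 n : cos_partial n.+1 0 = 1.
Proof.
rewrite /cos_partial big_ord_recl big1 => [|k _].
  by rewrite !expr0 mul1r divr1 addr0.
by rewrite expr0n/= mul0r mulr0.
Qed.

(** Starting from cos <= 1, signs are integrated: the sine remainder has the cosine remainder as
    derivative, and the next cosine remainder has minus the sine remainder. *)
Lemma taylor_alternating n x : 0 <= x ->
  0 <= (-1) ^+ n.+1 * (cos x - cos_partial n.+1 x) /\
  0 <= (-1) ^+ n.+1 * (sin x - sin_partial n.+1 x).
Proof.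
have sinP m : (forall y, 0 <= y -> 0 <= (-1) ^+ m * (cos y - cos_partial m y)) ->
    forall y, 0 <= y -> 0 <= (-1) ^+ m * (sin y - sin_partial m y).
  move=> h y y0; pose f z := (-1) ^+ m * (sin z - sin_partial m z) : R.
  apply: (@ge0_is_derive_ge0 f (fun z => (-1) ^+ m * (cos z - cos_partial m z))) => //.
    by rewrite /f sin0 sin_partial0 subrr mulr0.
  move=> z; have := is_derive_sin_partial m z => d.
  rewrite (_ : f = ((-1) ^+ m : R) \*: (sin - sin_partial m))//.
  exact: is_deriveZ.
have cosP m : (forall y, 0 <= y -> 0 <= (-1) ^+ m * (sin y - sin_partial m y)) ->
    forall y, 0 <= y -> 0 <= (-1) ^+ m.+1 * (cos y - cos_partial m.+1 y).
  move=> h y y0; pose f z := (-1) ^+ m.+1 * (cos z - cos_partial m.+1 z) : R.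
  apply: (@ge0_is_derive_ge0 f (fun z => (-1) ^+ m * (sin z - sin_partial m z))) => //.
    by rewrite /f cos0 cos_partial0 subrr mulr0.
  move=> z; have := is_derive_cos_partial m z => d.
  rewrite (_ : f = ((-1) ^+ m.+1 : R) \*: (cos - cos_partial m.+1))//.
  by apply: is_derive_eq; rewrite exprS /GRing.scale/=; ring.
suff : forall y, 0 <= y -> 0 <= (-1) ^+ n.+1 * (cos y - cos_partial n.+1 y).
  by move=> h x0; split; [exact: h|exact: sinP].
elim: n => [|n IHn]; last exact/cosP/sinP.
move=> y y0; rewrite /cos_partial big_ord1 expr0 mul1r divr1 expr1 mulN1r opprB.
by rewrite subr_ge0 cos_le1.
Qed.

Lemma cos_partial_le n x : 0 <= x -> odd n.+1 -> cos x <= cos_partial n.+1 x.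
Proof.
move=> x0 o; have [+ _] := taylor_alternating n x0.
by rewrite -signr_odd o expr1 mulN1r opprB subr_ge0.
Qed.

Lemma cos_partial_ge n x : 0 <= x -> ~~ odd n.+1 -> cos_partial n.+1 x <= cos x.
Proof.
move=> x0 /negbTE o; have [+ _] := taylor_alternating n x0.
by rewrite -signr_odd o expr0 mul1r subr_ge0.
Qed.

Lemma sin_le x : 0 <= x -> sin x <= x.
Proof.
move=> x0; have [_] := taylor_alternating 0 x0.
rewrite /sin_partial big_ord1 expr0 mul1r divr1 !expr1.
by rewrite mulN1r opprB subr_ge0.
Qed.

Lemma sin_ge x : 0 <= x -> x - x ^+ 3 / 6 <= sin x.
Proof.
move=> x0; have [_] := taylor_alternating 1 x0.
rewrite /sin_partial !big_ord_recl big_ord0 /= expr0 mul1r divr1 !expr1 addr0.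
by rewrite mulN1r -signr_odd expr0 mul1r subr_ge0.
Qed.

End Taylor.

(** * The angle defect bounds the area of a regular polygon *)

Section PolygonArea.
Variables (R : realType) (n : nat) (a : R).
Hypotheses (n_ge3 : (3 <= n)%N) (a_gt0 : 0 < a).

Let r := circumradius n a.
Let h : R := pi / n%:R.
(** This is tanh of the inradius. *)
Let t : R := sinh r * cos h / cosh r.

Let n_gt0 : 0 < n%:R :> R.
Proof. by rewrite ltr0n (leq_trans _ n_ge3). Qed.

Let r_gt0 : 0 < r. Proof. by case: (circumradiusP n_ge3 a_gt0). Qed.

Let sinh_r : sinh r * sin h = sinh (a / 2).
Proof. by case: (circumradiusP n_ge3 a_gt0). Qed.

Let C_gt0 : 0 < cosh r. Proof. exact: cosh_gt0. Qed.
Let S_gt0 : 0 < sinh r. Proof. by rewrite sinh_gt0. Qed.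
Let c_gt0 : 0 < cos h. Proof. exact: cos_pidivn_gt0. Qed.
Let s_gt0 : 0 < sin h. Proof. exact: sin_pidivn_gt0. Qed.
Let h_gt0 : 0 < h. Proof. by have /andP[] := pidivn_bounds R n_ge3. Qed.

Let t_gt0 : 0 < t. Proof. by rewrite divr_gt0// mulr_gt0. Qed.

Let t_lt : t < cos h.
Proof.
rewrite ltr_pdivrMr// mulrC ltr_pM2l// -(@ltr_pXn2r _ 2%N) ?nnegrE ?ltW//.
by rewrite cosh2E ltrDr.
Qed.

Let h_lt : h < pi / 2.
Proof.
have := pidivn_bounds R n_ge3 => /andP[_]; rewrite -/h => hle.
by have := @pi_gt0 R; lra.
Qed.

Let sector (k : nat) : set (R * R) := [set z | [/\ 0 <= z.1,
  (2 * k%:R + 1) * h - h <= z.2 <= (2 * k%:R + 1) * h + h &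
  sinh z.1 * cos (z.2 - (2 * k%:R + 1) * h) <= t * cosh z.1]].

Let polygon_sector (z : R * R) : 0 <= z.1 -> 0 <= z.2 < 2 * pi ->
  regular_polygon n r (hpolar z.1 z.2) -> exists k : 'I_n, sector k z.
Proof.
move=> z1 /andP[z20 z2pi] [_ zP].
have h2 : 0 < 2 * h by rewrite mulr_gt0.
have nh : n%:R * h = pi by rewrite mulrC divfK ?gt_eqF.
have x0 : 0 <= z.2 / (2 * h) by rewrite divr_ge0// ltW.
(* The sectors have width [2 * h], so the integer part of the quotient is the index of the sector
   containing the point. *)
have /andP[kl ku] := truncn_itv x0; set k := Num.truncn _ in kl ku.
have kn : (k < n)%N.
  rewrite -(ltr_nat R) (le_lt_trans kl)// ltr_pdivrMr//.
  by rewrite mulrCA nh.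
move: kl ku; rewrite ler_pdivlMr// ltr_pdivrMr// => kl ku.
exists (Ordinal kn); split=> //=.
  have -> : (2 * k%:R + 1) * h - h = k%:R * (2 * h) by ring.
  have -> : (2 * k%:R + 1) * h + h = k.+1%:R * (2 * h) by rewrite -natr1; ring.
  by rewrite kl ltW.
have := zP k kn; rewrite /polygon_vertex orient_hpolar.
set m := (2 * k%:R + 1) * h.
have -> : 2 * pi * k%:R / n%:R = m - h by rewrite /m /h; move: (n%:R^-1) => ?; ring.
have -> : 2 * pi * k.+1%:R / n%:R = m + h.
  by rewrite /m /h -natr1; move: (n%:R^-1) => ?; ring.
have -> : m + h - (m - h) = h + h by ring.
have -> : z.2 - (m + h) = (z.2 - m) - h by ring.
have -> : z.2 - (m - h) = (z.2 - m) + h by ring.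
rewrite sinB !sinD.
(* The orientation determinant is a positive multiple of the difference of the two sides of the
   sector inequality. *)
rewrite [X in 0 <= X](_ : _ = (2 * sin h * sinh r) *
    (sinh r * cos h * cosh z.1 - cosh r * (sinh z.1 * cos (z.2 - m)))); last by ring.
have K : 0 < 2 * sin h * sinh r by rewrite (mulr_gt0 _ S_gt0)// mulr_gt0.
rewrite (pmulr_rge0 _ K) subr_ge0.
by move=> H; rewrite /t [leRHS]mulrAC ler_pdivlMr// [leLHS]mulrC.
Qed.

(* Only one of the n half-planes is used in each sector, whence an inequality:
   this is the direction that is needed, and it spares the proof that the
   polygon is measurable. *)
Lemma harea_regular_polygon :
  (harea (regular_polygon n r) <= ((n%:R - 2) * pi - n%:R * polygon_angle n a)%:E)%E.
Proof.
rewrite /harea integral_mkcond.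
pose f k := (fun z : R * R => (sinh z.1)%:E) \_ (sector k).
have f0 k z : (0 <= f k z)%E.
  rewrite /f /patch; case: ifPn => // /[!inE]-[z1 _ _].
  by rewrite lee_fin sinh_ge0.
have mf k : measurable_fun setT (f k).
  apply/(measurable_restrictT _ _).1 => //; first exact: measurable_sector.
  apply: measurable_funTS; apply/measurable_EFinP.
  apply: (@measurableT_comp _ _ _ _ _ _ (@sinh R)); last exact: measurable_fst.
  by apply: continuous_measurable_fun; exact: continuous_sinh.
apply: (@le_trans _ _ (\int[lebesgue_measure \x lebesgue_measure]_z
    (\sum_(k <- index_enum 'I_n) f (nat_of_ord k) z))%E).
  apply: le_integral_nonmeasurable => z; rewrite /patch.
    by case: ifPn => // /[!inE]-[z1 _ _]; rewrite lee_fin sinh_ge0.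
  case: ifPn => [|_]; last by apply: sume_ge0.
  rewrite inE => -[z1 z2 zP]; have [k kz] := polygon_sector z1 z2 zP.
  rewrite (bigD1_seq k) ?mem_index_enum ?index_enum_uniq//=.
  rewrite {1}/f /patch ifT ?inE// leeDl//.
  by apply: sume_ge0.
have -> : (\int[lebesgue_measure \x lebesgue_measure]_z
    (\sum_(k <- index_enum 'I_n) f (nat_of_ord k) z))%E =
  (\sum_(k <- index_enum 'I_n)
     \int[lebesgue_measure \x lebesgue_measure]_z f (nat_of_ord k) z)%E.
  exact: (@ge0_integral_sum _ _ R (lebesgue_measure \x lebesgue_measure)%E
    _ measurableT _ (fun k : 'I_n => f k) (fun k => mf k) (fun k z _ => f0 k z)).
apply: (@le_trans _ _ (\sum_(k <- index_enum 'I_n)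
    (2 * asin (sin h / Num.sqrt (1 - t ^+ 2)) - 2 * h)%:E)%E).
  by apply: lee_sum => k _; exact: integral_sector_le.
rewrite sumEFin lee_fin sumr_const card_ord.
rewrite polygon_angleE// -/h.
set z := cos h / cosh (a / 2).
have ch0 := cosh_gt0 (a / 2).
have z0 : 0 < z by rewrite divr_gt0.
have c1 : cos h < 1 by have e := cos2Dsin2 h; have s0 := s_gt0; nra.
have z1 : z < 1.
  by rewrite ltr_pdivrMr// mul1r (lt_le_trans _ (cosh_ge1 _)).
have nh : n%:R * h = pi by rewrite mulrC divfK ?gt_eqF.
(* Half the polygon angle is [asin z]. Each sector then gets pi - 2 h - 2 asin z, the defect of an
   isosceles triangle with apex angle 2 h, and n * h = pi. *)
suff -> : sin h / Num.sqrt (1 - t ^+ 2) = sin (pi / 2 - asin z).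
  have ? : asin z <= pi / 2 by apply: asin_lepi2; lra.
  have ? : 0 <= asin z by apply: asin_ge0; lra.
  rewrite sinK ?in_itv/=; last by have := @pi_gt0 R; lra.
  rewrite -[leLHS]mulr_natr [leLHS](_ : _ =
    n%:R * (2 * (pi / 2)) - n%:R * (2 * asin z) - 2 * (n%:R * h)).
    by rewrite nh; lra.
  by ring.
rewrite sinB sin_pihalf cos_pihalf mul0r mul1r subr0 cos_asin; last by lra.
have q0 : 0 < 1 - t ^+ 2.
  rewrite subr_gt0 expr_lt1 ?ltW//.
  exact: lt_le_trans t_lt (cos_le1 h).
apply/eqP; rewrite -(@eqrXn2 _ 2%N) ?sqrtr_ge0 ?divr_ge0 ?sqrtr_ge0 ?ltW//; apply/eqP.
rewrite expr_div_n !sqr_sqrtr ?ltW//; last first.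
  by rewrite subr_gt0 expr_lt1 ?ltW.
have tE : t ^+ 2 = sinh r ^+ 2 * cos h ^+ 2 / (1 + sinh r ^+ 2).
  by rewrite /t expr_div_n (exprMn 2 (sinh r)) cosh2E.
have zE : z ^+ 2 = cos h ^+ 2 / (1 + sinh r ^+ 2 * (1 - cos h ^+ 2)).
  by rewrite /z expr_div_n cosh2E -sinh_r (exprMn 2 (sinh r)) sin2cos2.
have hS : 0 < sinh r ^+ 2 by rewrite exprn_gt0.
have hc : 0 < 1 - cos h ^+ 2 by rewrite -sin2cos2 exprn_gt0.
have hSc : 0 < 1 + sinh r ^+ 2 * (1 - cos h ^+ 2) by rewrite addr_gt0// mulr_gt0.
rewrite tE zE sin2cos2.
move: (sinh r ^+ 2) (cos h ^+ 2) hS hc hSc => S c hS hc hSc.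
have hne : 1 + S != 0 by rewrite gt_eqF// addr_gt0.
have hne2 : 1 + S * (1 - c) != 0 by rewrite gt_eqF.
by field; rewrite hne hne2.
Qed.

Lemma polygon_area_le :
  polygon_area n a <= (n%:R - 2) * pi - n%:R * polygon_angle n a.
Proof.
have := harea_regular_polygon; rewrite /polygon_area -/r.
(* With the upper bound this makes the area finite, so [fine] returns its true value. *)
have : (0 <= harea (regular_polygon n r))%E.
  by apply: integral_ge0 => z [z1 _ _]; rewrite lee_fin sinh_ge0.
case: (harea _) => [x|//|//] _; by rewrite lee_fin.
Qed.

End PolygonArea.

(** * Critical side lengths *)

Section PatternCurvature.
Variable R : realType.
Implicit Types (a b x : R) (f : seq nat) (n : nat).

(** Strict monotonicity makes the sublevel set the interval ]0, a]. The lemma serves the critical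
    lengths of vertices and of patterns alike. *)
Lemma sup_sublevel_root (K : R -> R) a : 0 < a ->
  (forall x y, 0 < x -> x < y -> K x < K y) -> K a = 0 ->
  sup [set x : R | 0 < x /\ K x <= 0] = a.
Proof.
move=> a0 incK Ka.
have -> : [set x : R | 0 < x /\ K x <= 0] = `]0, a]%classic.
  apply/seteqP; split=> x /=; rewrite in_itv/=.
    move=> [-> Kx]/=; rewrite leNgt; apply/negP => ax.
    by have := incK _ _ a0 ax; rewrite Ka ltNge Kx.
  move=> /andP[x0]; rewrite le_eqVlt => /predU1P[->|xa]; first by rewrite Ka.
  by split=> //; rewrite -Ka ltW// incK.
by rewrite sup_itv// bnd_simp.
Qed.

Lemma cos_pidivn_lt1 n : (3 <= n)%N -> cos (pi / n%:R) < 1 :> R.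
Proof.
move=> n3; have e := cos2Dsin2 (pi / n%:R : R).
by have s0 := sin_pidivn_gt0 R n3; nra.
Qed.

Lemma ratio_bounds n a : (3 <= n)%N -> 0 < cos (pi / n%:R) / cosh (a / 2) < 1.
Proof.
move=> n3; rewrite divr_gt0 ?cos_pidivn_gt0 ?cosh_gt0//=.
rewrite ltr_pdivrMr ?cosh_gt0// mul1r.
exact: lt_le_trans (cos_pidivn_lt1 n3) (cosh_ge1 _).
Qed.

Lemma ltr_asin_ratio n a b : (3 <= n)%N -> 0 <= a -> a < b ->
  asin (cos (pi / n%:R) / cosh (b / 2)) < asin (cos (pi / n%:R) / cosh (a / 2)).
Proof.
move=> n3 a0 ab; have /andP[? ?] := ratio_bounds a n3.
have /andP[? ?] := ratio_bounds b n3.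
rewrite ltr_asin ?in_itv/=; [|lra|lra].
rewrite ltr_pM2l ?cos_pidivn_gt0// ltf_pV2 ?posrE ?cosh_gt0//.
apply: ltr_cosh; lra.
Qed.

Lemma pattern_curvature_nil a : pattern_curvature a [::] = 2 * pi.
Proof. by rewrite /pattern_curvature big_nil subr0. Qed.

Lemma pattern_curvature_cons a n f : pattern_curvature a (n :: f) =
  pattern_curvature a f - 2 * asin (cos (pi / n%:R) / cosh (a / 2)).
Proof. by rewrite /pattern_curvature big_cons; ring. Qed.

Lemma le_pattern_curvature f a b : all (leq 3) f -> 0 <= a -> a <= b ->
  pattern_curvature a f <= pattern_curvature b f.
Proof.
move=> f3 a0; rewrite le_eqVlt => /predU1P[->//|ab].
elim: f f3 => [|n f IHf] /=; first by rewrite !pattern_curvature_nil.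
move=> /andP[n3 /IHf]; rewrite !pattern_curvature_cons.
by have := ltr_asin_ratio n3 a0 ab; lra.
Qed.

Lemma lt_pattern_curvature f a b : f != [::] -> all (leq 3) f ->
  0 <= a -> a < b -> pattern_curvature a f < pattern_curvature b f.
Proof.
case: f => // n f _ /= /andP[n3 f3] a0 ab; rewrite !pattern_curvature_cons.
have := le_pattern_curvature f3 a0 (ltW ab).
by have := ltr_asin_ratio n3 a0 ab; lra.
Qed.

Lemma continuous_asin_ratio n : (3 <= n)%N ->
  continuous (fun a : R => asin (cos (pi / n%:R) / cosh (a / 2))).
Proof.
move=> n3 a.
apply: (@continuous_comp _ _ _ (fun a : R => cos (pi / n%:R) / cosh (a / 2))).
  apply: cvgM; first exact: cvg_cst.
  apply: cvgV; first by rewrite gt_eqF ?cosh_gt0.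
  apply: (@continuous_comp _ _ _ (fun a : R => a / 2)).
    by apply: cvgM; [exact: cvg_id|exact: cvg_cst].
  exact: continuous_cosh.
apply: continuous_asin; have /andP[? ?] := ratio_bounds a n3; lra.
Qed.

Lemma continuous_pattern_curvature f : all (leq 3) f ->
  continuous (fun a : R => pattern_curvature a f).
Proof.
elim: f => [_|n f IHf /= /andP[n3 f3]] a.
  rewrite (_ : (fun _ => _) = cst (2 * pi)); first exact: cvg_cst.
  by apply/funext => x; rewrite pattern_curvature_nil.
rewrite (_ : (fun _ => _) = (fun x => pattern_curvature x f -
    2 * asin (cos (pi / n%:R) / cosh (x / 2)))); last first.
  by apply/funext => x; rewrite pattern_curvature_cons.
apply: cvgB; first exact: IHf.
by apply: cvgM; [exact: cvg_cst|exact: continuous_asin_ratio].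
Qed.

Lemma pattern_curvature_pos f : all (leq 3) f ->
  exists2 b : R, 0 <= b & 0 < pattern_curvature b f.
Proof.
case: (eqVneq f [::]) => [-> _|f0 f3].
  by exists 0 => //; rewrite pattern_curvature_nil mulr_gt0// pi_gt0.
have m3 : (3 <= (size f).+2)%N by case: f f0 {f3}.
have p_in : pi / (size f).+2%:R \in `[- (pi / 2), pi / 2 : R].
  have [h1 h2] : - (pi / 2) <= (pi : R) / (size f).+2%:R /\
      (pi : R) / (size f).+2%:R <= pi / 2.
    have := pidivn_bounds R m3; move: ((pi : R) / (size f).+2%:R) => p.
    by have := @pi_gt0 R; lra.
  by rewrite in_itv/= h1 h2.
have s0 := sin_pidivn_gt0 R m3; set s := sin _ in s0.
have s1 : 1 <= s^-1 by rewrite invf_ge1// sin_le1.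
(* With k the size of [f], the side length [b * 2] is such that 1 / cosh b = sin (pi / (k + 2)).
   Each half-angle is then at most pi / (k + 2), and the k angles sum to less than 2 pi. *)
have [b b0 hb] := cosh_surj s1.
exists (b * 2); first by rewrite mulr_ge0.
have le n : (3 <= n)%N -> asin (cos (pi / n%:R) / cosh (b * 2 / 2)) <= pi / (size f).+2%:R.
  move=> n3; have /andP[? ?] := ratio_bounds (b * 2) n3.
  rewrite -[leRHS](sinK p_in).
  have c1 := cos_pidivn_lt1 n3.
  have [h1 h2] : -1 <= s /\ s <= 1 by rewrite sin_geN1 sin_le1.
  have [h3 h4] : -1 <= cos (pi / n%:R) / cosh (b * 2 / 2) :> R /\
    cos (pi / n%:R) / cosh (b * 2 / 2) <= 1 :> R by split; lra.
  rewrite leNgt ltr_asin -?leNgt ?in_itv/= ?h1 ?h2 ?h3 ?h4//.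
  rewrite mulfK// hb invrK -/s.
  by rewrite ler_piMl// ltW.
have : \sum_(n <- f) 2 * asin (cos (pi / n%:R) / cosh (b * 2 / 2)) <=
    \sum_(n <- f) 2 * (pi / (size f).+2%:R) :> R.
  rewrite big_seq [leRHS]big_seq; apply: ler_sum => n nf.
  by rewrite ler_pM2l// le// (allP f3).
rewrite big_const_seq count_predT iter_addr_0.
rewrite /pattern_curvature subr_gt0 => /le_lt_trans; apply.
rewrite -[ltLHS]mulr_natr -[ltLHS]mulrA ltr_pM2l// [ltLHS]mulrAC ltr_pdivrMr ?ltr0n//.
by rewrite ltr_pM2l ?pi_gt0// ltr_nat.
Qed.

Lemma pattern_curvature_root f a : all (leq 3) f -> 0 < a ->
  pattern_curvature a f <= 0 -> exists2 b, a <= b & pattern_curvature b f = 0.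
Proof.
move=> f3 a0 Ka; have [b b0 Kb] := pattern_curvature_pos f3.
have ab : a <= b.
  rewrite leNgt; apply/negP => /ltW ba.
  by have := le_pattern_curvature f3 b0 ba; lra.
have [||c] := @IVT R (fun x => pattern_curvature x f) a b 0 ab.
- exact: continuous_subspaceT (continuous_pattern_curvature f3).
- by rewrite ge_min le_max Ka (ltW Kb) orbT.
- by rewrite in_itv/= => /andP[ac _] Kc; exists c.
Qed.

Lemma pattern_acritP f a : f != [::] -> all (leq 3) f -> 0 < a ->
  pattern_curvature a f = 0 -> pattern_acrit R f = a.
Proof.
move=> f0 f3 a0 Ka; apply: sup_sublevel_root => // x y x0 xy.
by apply: lt_pattern_curvature => //; exact: ltW.
Qed.

End PatternCurvature.

(** * Cubic maps of genus 2 *)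

Section CombinatorialMaps.
Variable G : cmap.
Implicit Types (x y : G) (v s : {set G}).

Lemma big_porbits (V : nmodType) (p : {perm G}) (F : G -> V) :
  \sum_(v in porbits p) \sum_(x in v) F x = \sum_x F x.
Proof.
rewrite [RHS](partition_big_imset (porbit p)).
apply: eq_bigr => v /imsetP[y _ ->]; apply: eq_bigl => x.
by rewrite eq_porbit_mem.
Qed.

Lemma mem_porbit1 (p : {perm G}) x : p x \in porbit p x.
Proof. by have := mem_porbit p 1 x; rewrite expg1. Qed.

Lemma vertex_of_in x : vertex_of x \in vertices G.
Proof. exact: imset_f. Qed.

Lemma face_of_in x : face_of x \in faces G.
Proof. exact: imset_f. Qed.

Lemma mem_face_of x s : s \in faces G -> x \in s -> face_of x = s.
Proof.
by move=> /imsetP[y _ ->] xy; apply/eqP; rewrite eq_porbit_mem.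
Qed.

Lemma mem_vertex_of x v : v \in vertices G -> x \in v -> vertex_of x = v.
Proof.
by move=> /imsetP[y _ ->] xy; apply/eqP; rewrite eq_porbit_mem.
Qed.

Lemma vertex_of_node x : vertex_of (node G x) = vertex_of x.
Proof. by apply/eqP; rewrite eq_porbit_mem mem_porbit1. Qed.

(** [face] sends [edge G x] to [node G x], because [edge] is an involution. Hence adjacent vertices
    see the same two faces along their common edge. *)
Lemma face_of_node x : face_of (node G x) = face_of (edge G x).
Proof.
apply/eqP; rewrite eq_porbit_mem -[X in node G X](edgeK x).
by rewrite -permM mem_porbit1.
Qed.

Lemma mem_edge_of x y : (y \in edge_of x) = (y == x) || (y == edge G x).
Proof.
apply/porbitP/orP => [[i ->]|[]/eqP->].
- elim: i => [|i [] /eqP IHi]; first by rewrite expg0 perm1 eqxx; left.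
    by right; rewrite expgSr permM IHi.
  by left; rewrite expgSr permM IHi edgeK.
- by exists 0%N; rewrite expg0 perm1.
- by exists 1%N; rewrite expg1.
Qed.

Lemma card_darts_edges : #|G| = (#|edges G|).*2.
Proof.
rewrite -mul2n mulnC -sum_nat_const -sum1_card -(big_porbits (edge G)).
apply: eq_bigr => e /imsetP[x _ ->]; rewrite sum1_card.
rewrite (eq_card (B := mem [:: x; edge G x])); last first.
  by move=> y; rewrite mem_edge_of !inE.
by apply/card_uniqP; rewrite /= inE eq_sym edge_neq.
Qed.

(** Two distinct darts of one face cannot share an edge, whose two sides lie in different faces. *)
Lemma face_deg_card s : edges_two_faces G -> s \in faces G -> face_deg s = #|s|.
Proof.
move=> two sF; rewrite /face_deg card_in_imset// => x y xs ys /eqP.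
rewrite eq_porbit_mem mem_edge_of => /predU1P[//|/eqP xy].
have /eqP[] := two y.
by rewrite -xy (mem_face_of sF ys) (mem_face_of sF xs).
Qed.

Lemma vertex_deg_card v : simple_graph G -> v \in vertices G -> vertex_deg v = #|v|.
Proof.
move=> [_ simple] vV; rewrite /vertex_deg card_in_imset// => x y xv yv h.
by apply: simple => //; rewrite (mem_vertex_of vV xv) (mem_vertex_of vV yv).
Qed.

Lemma sum_vertex3 (V : nmodType) (F : G -> V) x : #|vertex_of x| = 3%N ->
  \sum_(y in vertex_of x) F y = F x + F (node G x) + F (node G (node G x)).
Proof.
move=> c3; have u := uniq_traject_porbit (node G) x; rewrite c3 in u.
rewrite (eq_bigl (mem (traject (node G) x 3))); last first.
  by move=> y; rewrite porbit_traject -/(vertex_of x) c3.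
by rewrite -big_uniq//= !big_cons big_nil addr0 addrA.
Qed.

Lemma cmap_connected_ind (P : pred G) x0 : P x0 ->
  (forall x, P x -> P (edge G x)) -> (forall x, P x -> P (node G x)) ->
  forall x, P x.
Proof.
move=> P0 Pe Pn x; have /connectP[p + ->] := dart_connect x0 x.
elim: p x0 P0 => //= y p IHp x0 P0 /andP[/orP[] /eqP yE] /IHp; apply.
  by rewrite -yE Pe.
by rewrite -yE Pn.
Qed.

End CombinatorialMaps.

(** * A uniform gap between the curvatures of adjacent vertices *)

Section CurvatureGap.
Variable R : realType.
Implicit Types (x y a : R).

Lemma pi_bounds : 2 <= pi :> R /\ pi <= 4 :> R.
Proof. by split; [exact: pi_ge2|have := @pihalf_lt2 R; lra]. Qed.

Lemma sin_ge_half x : 0 <= x <= 4 / 3 -> x / 2 <= sin x.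
Proof.
move=> /andP[x0 x1]; apply: le_trans (sin_ge x0).
have : x ^+ 2 <= 3.
  have : x ^+ 2 <= (4 / 3) ^+ 2 by rewrite ler_pXn2r ?nnegrE//; lra.
  lra.
by rewrite exprS; nra.
Qed.

(** With u = pi / m and v = pi / n, the difference is 2 sin ((u + v) / 2) sin ((u - v) / 2), at
    least (u + v) (u - v) / 8. As u + v >= 4 / 126 and u - v >= 2 / 126 ^ 2, this is at least 126 ^
    -3, which exceeds 10 ^ -7. *)
Lemma cos_pidivn_gap (m n : nat) : (3 <= m)%N -> (m < n)%N -> (n <= 126)%N ->
  10^-1 ^+ 7 <= cos (pi / n%:R) - cos (pi / m%:R) :> R.
Proof.
move=> m3 mn n126; have n3 : (3 <= n)%N by exact: leq_trans m3 (ltnW mn).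
have [p2 p4] := pi_bounds.
have /andP[hm0 hm1] := pidivn_bounds R m3; have /andP[hn0 hn1] := pidivn_bounds R n3.
have m0 : 0 < m%:R :> R by rewrite ltr0n (leq_trans _ m3).
have n0 : 0 < n%:R :> R by rewrite ltr0n (leq_trans _ n3).
have mn1 : m%:R + 1 <= n%:R :> R by rewrite natr1 ler_nat.
have n1 : n%:R <= 126 :> R by rewrite ler_nat.
set u : R := pi / m%:R in hm0 hm1 *; set v : R := pi / n%:R in hn0 hn1 *.
have vu : v < u.
  by rewrite ltr_pM2l ?pi_gt0// ltf_pV2 ?posrE// ltr_nat.
have -> : cos v - cos u = 2 * (sin ((u + v) / 2) * sin ((u - v) / 2)).
  have id (b c : R) : cos (b - c) - cos (b + c) = 2 * (sin b * sin c).
    by rewrite cosB cosD; ring.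
  by rewrite -id; congr (cos _ - cos _); field.
have h1 : (u + v) / 2 / 2 <= sin ((u + v) / 2) by apply: sin_ge_half; lra.
have h2 : (u - v) / 2 / 2 <= sin ((u - v) / 2) by apply: sin_ge_half; lra.
have h3 : (u + v) / 2 / 2 * ((u - v) / 2 / 2) <= sin ((u + v) / 2) * sin ((u - v) / 2).
  by apply: ler_pM => //; lra.
have um : u * m%:R = pi by rewrite /u divfK ?gt_eqF.
have vn : v * n%:R = pi by rewrite /v divfK ?gt_eqF.
have v126 : 2 <= v * 126.
  by apply: le_trans (_ : v * n%:R <= _); [rewrite vn|rewrite ler_wpM2l// ltW].
(* Since u * m = v * n = pi, the right side equals u * (n - m). *)
have uvn : u <= (u - v) * n%:R by rewrite mulrBl vn -um -mulrBr ler_peMr ?(ltW hm0)//; lra.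
have uv126 : v <= (u - v) * 126.
  apply: (@le_trans _ _ ((u - v) * n%:R)); first exact: le_trans (ltW vu) uvn.
  by rewrite ler_wpM2l// subr_ge0 ltW.
have h4 : 4 / 126 * (2 / 126 / 126) <= (u + v) * (u - v).
  by apply: ler_pM; lra.
have -> : 10^-1 ^+ 7 = 1 / (10 * 10 * 10 * 10 * 10 * 10 * 10) :> R by field.
lra.
Qed.

(** Sine is 1-Lipschitz: sin (b + c) - sin (b - c) = 2 cos b sin c <= 2 c. *)
Lemma ler_sub_asin x y : 0 <= x -> x <= y -> y <= 1 -> y - x <= asin y - asin x.
Proof.
move=> x0 xy y1.
have xi : x \in `[(-1), 1] by rewrite in_itv/=; apply/andP; split; lra.
have yi : y \in `[(-1), 1] by rewrite in_itv/=; apply/andP; split; lra.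
have d0 : 0 <= asin y - asin x.
  by rewrite subr_ge0 leNgt ltr_asin// -leNgt.
rewrite -{1}(asinK xi) -{1}(asinK yi).
have {d0} [b [c [c0 yE xE]]] : exists b c, [/\ 0 <= c, asin y = b + c & asin x = b - c].
  exists ((asin y + asin x) / 2), ((asin y - asin x) / 2).
  by split; [rewrite divr_ge0|field|field].
rewrite yE xE; have -> : sin (b + c) - sin (b - c) = 2 * (cos b * sin c) by rewrite sinD sinB; ring.
have -> : b + c - (b - c) = 2 * c by ring.
rewrite ler_pM2l//.
apply: le_trans (sin_le c0); rewrite ler_piMl ?cos_le1//.
apply: sin_ge0_pi; rewrite c0/=.
have := asin_lepi2 (x := y); have := asin_geNpi2 (x := x); have := @pi_gt0 R.
by rewrite yE xE; lra.
Qed.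

(** The bound 2 / 3 is used for three half-angles at once: three full angles then sum to less than 4
    <= 2 pi. *)
Lemma asin_le_half x : 0 <= x <= 1 / 2 -> asin x < 2 / 3.
Proof.
move=> x01; have [p2 _] := pi_bounds.
have h : (2 / 3 : R) \in `[- (pi / 2), pi / 2].
  by rewrite in_itv/=; apply/andP; split; lra.
have s0 : 1 / 2 < sin (2 / 3) :> R.
  by have := @sin_ge R (2 / 3); rewrite !exprS expr0; lra.
rewrite -[ltRHS](sinK h) ltr_asin.
- lra.
- by rewrite in_itv/=; apply/andP; split; lra.
- by rewrite in_itv/= sin_le1 sin_geN1.
Qed.

(** Zero curvature forces cosh (a / 2) <= 2, since otherwise the angles would be too small. The
    quotients inside the arcsines thus differ by at least 10 ^ -7 / 2, and the curvatures by twice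
    the gap of the arcsines. The swap of i and j reflects the view from the other end of the
    edge. *)
Lemma curvature_gap a (i j m n : nat) :
  (3 <= i)%N -> (3 <= j)%N -> (3 <= m)%N -> (m < n)%N -> (n <= 126)%N ->
  pattern_curvature a [:: i; j; m] = 0 ->
  pattern_curvature a [:: j; i; n] <= - (10^-1 ^+ 7).
Proof.
move=> i3 j3 m3 mn n126; have n3 : (3 <= n)%N by exact: leq_trans m3 (ltnW mn).
rewrite !pattern_curvature_cons pattern_curvature_nil => K0.
have [p2 _] := pi_bounds.
have ch0 := cosh_gt0 (a / 2).
have ch2 : cosh (a / 2) <= 2.
  rewrite leNgt; apply/negP => ch2.
  have small k : (3 <= k)%N -> asin (cos (pi / k%:R) / cosh (a / 2)) < 2 / 3 :> R.
    move=> k3; have c0 := cos_pidivn_gt0 R k3; have c1 := cos_le1 (pi / k%:R : R).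
    apply: asin_le_half; rewrite divr_ge0 ?(ltW c0) ?(ltW ch0)//= ler_pdivrMr//; lra.
  have := small _ i3; have := small _ j3; have := small _ m3; lra.
have g := cos_pidivn_gap m3 mn n126.
have /andP[cm0 _] := ratio_bounds a m3; have /andP[_ cn1] := ratio_bounds a n3.
have le_mn : cos (pi / m%:R) / cosh (a / 2) + 10^-1 ^+ 7 / 2 <= cos (pi / n%:R) / cosh (a / 2).
  rewrite -lerBrDl -mulrBl ler_pM ?invr_ge0 ?exprn_ge0// ?lef_pV2 ?posrE//.
have e0 : 0 < 10^-1 ^+ 7 :> R by rewrite exprn_gt0// invr_gt0.
have := @ler_sub_asin _ _ (ltW cm0) _ (ltW cn1).
by move: e0 le_mn; move: (10^-1 ^+ 7) => e e0 le_mn; lra.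
Qed.

End CurvatureGap.

Lemma asin_cos_pidivn (R : realType) (n : nat) : (3 <= n)%N ->
  asin (cos (pi / n%:R)) = pi / 2 - pi / n%:R :> R.
Proof.
move=> n3; have -> : cos (pi / n%:R) = sin (pi / 2 - pi / n%:R) :> R.
  by rewrite sinB sin_pihalf cos_pihalf mul1r mul0r subr0.
have /andP[h1 h2] := pidivn_bounds R n3; have := @pi_gt0 R => p0.
move: (pi / n%:R : R) h1 h2 => p h1 h2.
by rewrite sinK// in_itv/=; apply/andP; split; lra.
Qed.

Lemma le_asin_ratio_deg (R : realType) (a : R) (m n : nat) : (3 <= m)%N -> (m <= n)%N ->
  asin (cos (pi / m%:R) / cosh (a / 2)) <= asin (cos (pi / n%:R) / cosh (a / 2)).
Proof.
move=> m3 mn; have n3 : (3 <= n)%N by exact: leq_trans m3 mn.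
have /andP[m0 m1] := ratio_bounds a m3; have /andP[n0 n1] := ratio_bounds a n3.
rewrite leNgt ltr_asin; first last.
- by rewrite in_itv/=; apply/andP; split; lra.
- by rewrite in_itv/=; apply/andP; split; lra.
rewrite -leNgt ler_pM2r ?invr_gt0 ?cosh_gt0// leNgt ltr_cos; first last.
- have /andP[? ?] := pidivn_bounds R n3; have := @pi_gt0 R => p0.
  by rewrite in_itv/=; apply/andP; split; lra.
- have /andP[? ?] := pidivn_bounds R m3; have := @pi_gt0 R => p0.
  by rewrite in_itv/=; apply/andP; split; lra.
rewrite -leNgt ler_pM2l ?pi_gt0// lef_pV2 ?posrE ?ltr0n ?ler_nat//.
- exact: leq_trans n3.
- exact: leq_trans m3.
Qed.

Lemma inf_min (R : realType) (E : set R) (m : R) : E m -> lbound E m -> inf E = m.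
Proof.
move=> Em lbm; apply/eqP; rewrite eq_le; apply/andP; split.
  by apply: ge_inf => //; exists m.
by apply: lb_le_inf => //; exists m.
Qed.

(** In terms of inverses, 1 / i + 1 / j < 1 / 2 implies 1 / i + 1 / j <= 10 / 21, the value at (3,
    7). *)
Lemma inv_degree_gap (i j : nat) : (3 <= i)%N -> (3 <= j)%N ->
  (2 * (i + j) < i * j)%N -> (21 * (i + j) <= 10 * (i * j))%N.
Proof.
move=> i3 j3; wlog le_ij : i j i3 j3 / (i <= j)%N.
  move=> wl; case: (leqP i j) => [le_ij|/ltnW le_ji]; first exact: wl.
  by rewrite [(i + j)%N]addnC [(i * j)%N]mulnC; exact: wl.
case: (ltngtP i 4) => [i4|i5|->]; [|nia|lia].
have -> : i = 3%N by lia.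
by lia.
Qed.

(** * Gauss-Bonnet and the critical area of cubic surfaces of genus 2 *)

Section CubicSurface.
Variables (R : realType) (G : cmap).
Hypotheses (spG : semiplanar G) (genus2 : has_genus G 2).
Hypothesis cubic : forall v : {set G}, v \in vertices G -> (vertex_deg v <= 3)%N.
Implicit Types (x y : G) (v s : {set G}) (a : R).

Let d x := face_deg (face_of x).

Let card_face x : d x = #|face_of x|.
Proof. by case: spG => _ _ two _ _; rewrite /d face_deg_card// face_of_in. Qed.

Let d_ge3 x : (3 <= d x)%N.
Proof. by case: spG => _ _ _ _ [_ /(_ _ (face_of_in x))]. Qed.

Let card_vertex v : v \in vertices G -> #|v| = 3%N.
Proof.
move=> vV; case: spG => simple _ _ _ [/(_ _ vV) ge3 _].
by rewrite -(vertex_deg_card simple vV); apply/eqP; rewrite eqn_leq ge3 cubic.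
Qed.

Let d_node x : d (node G x) = d (edge G x).
Proof. by rewrite /d face_of_node. Qed.

Let sum_faces (F : G -> R) : \sum_(s in faces G) \sum_(x in s) F x = \sum_x F x.
Proof. exact: big_porbits. Qed.

Let sum_vertices (F : G -> R) : \sum_(v in vertices G) \sum_(x in v) F x = \sum_x F x.
Proof. exact: big_porbits. Qed.

Let card_vertices : #|G|%:R = 3 * #|vertices G|%:R :> R.
Proof.
rewrite -natrM; congr _%:R; rewrite mulnC -sum_nat_const -sum1_card.
rewrite -(big_porbits (node G)); apply: eq_bigr => v vV.
by rewrite sum1_card card_vertex.
Qed.

Let euler : #|vertices G|%:R / 2 = #|faces G|%:R + 2 :> R.
Proof.
have hE : #|G|%:R = 2 * #|edges G|%:R :> R.
  by rewrite card_darts_edges -muln2 natrM mulrC.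
have hg : #|vertices G|%:R + #|faces G|%:R + 4 = #|edges G|%:R + 2 :> R.
  by move: genus2 => /(congr1 (fun k => k%:R : R)); rewrite !natrD.
by move: card_vertices hE hg; lra.
Qed.

Let sum_inv_deg : \sum_x (d x)%:R^-1 = #|faces G|%:R :> R.
Proof.
rewrite -sum_faces -sumr_const; apply: eq_bigr => s sF.
rewrite (eq_bigr (fun=> (#|s|%:R^-1 : R))); last first.
  by move=> x xs; rewrite card_face (mem_face_of sF xs).
rewrite sumr_const -[LHS]mulr_natl divff// pnatr_eq0 -lt0n.
by case/imsetP: sF => x _ ->; apply/card_gt0P; exists x; exact: porbit_id.
Qed.

(* The faces around the initial vertex of the dart x. The first two of them lie
   on either side of the edge of x, so they recur in [pattern (edge G x)]. *)
Let pattern x : seq nat := [:: d x; d (node G x); d (node G (node G x))].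

Let pattern_ge3 x : all (leq 3) (pattern x).
Proof. by rewrite /= !d_ge3. Qed.

Lemma curvatureE a x : 0 < a -> curvature a (vertex_of x) = pattern_curvature a (pattern x).
Proof.
move=> a0; rewrite /curvature /pattern_curvature /total_angle; congr (_ - _).
rewrite sum_vertex3 ?card_vertex ?vertex_of_in//.
by rewrite !big_cons big_nil !polygon_angleE ?d_ge3// addr0 addrA.
Qed.

(** Curvature strictly increases with the side length, so it is negative at 0, where the angles are
    Euclidean and the curvature is 2 pi times the sum of inverse degrees minus pi. *)
Lemma pattern_defect a x : 0 < a -> pattern_curvature a (pattern x) <= 0 ->
  (d x)%:R^-1 + (d (node G x))%:R^-1 + (d (node G (node G x)))%:R^-1 < 1 / 2 :> R.
Proof.
move=> a0 Ka; have := lt_pattern_curvature (isT : pattern x != [::]) (pattern_ge3 x) (lexx 0) a0.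
move: Ka; set k := pattern_curvature a _ => Ka; clearbody k.
have flat n : (3 <= n)%N -> asin (cos (pi / n%:R) / cosh (0 / 2)) = pi / 2 - pi * n%:R^-1 :> R.
  by move=> n3; rewrite mul0r cosh0 divr1 asin_cos_pidivn.
rewrite !pattern_curvature_cons pattern_curvature_nil !flat ?d_ge3// => K0.
rewrite -(ltr_pM2l (@pi_gt0 R)) !mulrDr.
by move: K0 Ka; lra.
Qed.

Lemma face_deg_le :
  (forall x, (d x)%:R^-1 + (d (node G x))%:R^-1 + (d (node G (node G x)))%:R^-1
     < 1 / 2 :> R) ->
  forall x, (d x <= 126)%N.
Proof.
move=> defect x.
(* At a cubic vertex [w] is the combinatorial curvature Phi, the three terms 1 / 6 adding up to 1 /
   2. *)
pose w v : R := \sum_(y in v) ((d y)%:R^-1 - 1 / 6).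
have w_lt0 v : v \in vertices G -> w v <= 0.
  case/imsetP=> y _ ->; rewrite /w sum_vertex3 ?card_vertex ?vertex_of_in//.
  by have := defect y; lra.
have sum_w : \sum_(v in vertices G) w v = - 2.
  rewrite sum_vertices big_split/= sum_inv_deg sumr_const.
  by rewrite -[(- (1 / 6)) *+ _]mulr_natr card_vertices; move: euler; lra.
have inj : {in face_of x &, injective (@vertex_of G)}.
  by case: spG => _ disk _ _ _; exact: disk (face_of_in x).
have d0 : 0 < (d x)%:R :> R by rewrite ltr0n (leq_trans _ (d_ge3 x)).
have w_face y : y \in face_of x -> w (vertex_of y) <= (d x)%:R^-1 - 1 / 42.
  move=> yx; rewrite /w sum_vertex3 ?card_vertex ?vertex_of_in//.
  have -> : d y = d x by rewrite /d (mem_face_of (face_of_in x) yx).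
  have := defect y; have -> : d y = d x by rewrite /d (mem_face_of (face_of_in x) yx).
  have := d_ge3 (node G y); have := d_ge3 (node G (node G y)).
  move: (d (node G y)) (d (node G (node G y))) => i j j3 i3 hd.
  have i0 : 0 < i%:R :> R by rewrite ltr0n (leq_trans _ i3).
  have j0 : 0 < j%:R :> R by rewrite ltr0n (leq_trans _ j3).
  have ij : i%:R^-1 + j%:R^-1 = (i%:R + j%:R) / (i%:R * j%:R) :> R.
    by field; rewrite !gt_eqF.
  suff : i%:R^-1 + j%:R^-1 <= 10 / 21 :> R by lra.
  have : i%:R^-1 + j%:R^-1 < 1 / 2 :> R.
    by have : 0 < (d x)%:R^-1 :> R; [rewrite invr_gt0|lra].
  rewrite ij ltr_pdivrMr ?mulr_gt0// ler_pdivrMr ?mulr_gt0//.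
  rewrite -natrM -natrD => lt_ij.
  have : (2 * (i + j) < i * j)%N by rewrite -(ltr_nat R) natrM; lra.
  move=> /(inv_degree_gap i3 j3); rewrite -(ler_nat R) !natrM; lra.
(* A disk face passes through [d x] distinct vertices, and every other vertex has [w] at most 0. So
   -2 <= 1 - d / 42, that is d <= 126. *)
have : - 2 <= \sum_(y in face_of x) ((d x)%:R^-1 - 1 / 42) :> R.
  rewrite -sum_w (big_setID [set vertex_of y | y in face_of x]%SET)/=.
  have sub : [set vertex_of y | y in face_of x]%SET \subset vertices G.
    by apply/fintype.subsetP => _ /imsetP[y _ ->]; exact: vertex_of_in.
  rewrite (finset.setIidPr sub) big_imset//= -[leRHS]addr0 lerD//.
    by apply: ler_sum => y; exact: w_face.
  by apply: sumr_le0 => v; rewrite finset.inE => /andP[_]; exact: w_lt0.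
rewrite sumr_const -card_face -[leRHS]mulr_natr mulrBl mulVf ?gt_eqF// => h.
by rewrite -(ler_nat R); lra.
Qed.

(** The defect of each face is spread evenly over its darts. Summing the inverse degrees counts the
    faces, and Euler's formula turns the remaining count into 4 pi. *)
Lemma surface_area_le a : 0 < a ->
  surface_area G a <= 4 * pi + \sum_(v in vertices G) curvature a v.
Proof.
move=> a0; pose f x := polygon_angle (d x) a.
have -> : \sum_(v in vertices G) curvature a v =
    2 * pi * #|vertices G|%:R - \sum_x f x.
  by rewrite big_split/= sumr_const sumrN sum_vertices mulr_natr.
have : surface_area G a <= \sum_(s in faces G) \sum_(x in s) (pi - f x - 2 * pi * (d x)%:R^-1).
  apply: ler_sum => s sF; have [x xs] : exists x, x \in s.
    by case/imsetP: sF => x _ ->; exists x; exact: porbit_id.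
  have sE := mem_face_of sF xs.
  rewrite (eq_bigr (fun=> pi - f x - 2 * pi * (d x)%:R^-1)) => [|y ys]; last first.
    by rewrite /f /d (mem_face_of sF ys) sE.
  rewrite sumr_const -sE -card_face -[leRHS]mulr_natr.
  apply: le_trans (polygon_area_le (d_ge3 x) a0) _; rewrite -/(f x).
  have d0 : (d x)%:R != 0 :> R by rewrite pnatr_eq0 -lt0n (leq_trans _ (d_ge3 x)).
  rewrite le_eqVlt; apply/orP; left; apply/eqP; field.
  exact: d0.
rewrite sum_faces !sumrB -mulr_sumr sum_inv_deg sumr_const.
rewrite -[pi *+ _]mulr_natr card_vertices; move/le_trans; apply.
have e : #|vertices G|%:R = 2 * #|faces G|%:R + 4 :> R by move: euler; lra.
rewrite e; lra.
Qed.

Hypothesis nonpos : exists2 a : R, 0 < a & forall v, v \in vertices G -> curvature a v <= 0.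

(** Some length has nonpositive curvature, so the increasing curvature has a root from there on, and
    the supremum is that root. *)
Let vertex_acritP x : 0 < vertex_acrit R (vertex_of x) /\
  pattern_curvature (vertex_acrit R (vertex_of x)) (pattern x) = 0.
Proof.
have [a a0 Ka] := nonpos.
have := Ka _ (vertex_of_in x); rewrite curvatureE// => Kx.
have [b ab Kb] := pattern_curvature_root (pattern_ge3 x) a0 Kx.
have b0 : 0 < b by exact: lt_le_trans ab.
have -> : vertex_acrit R (vertex_of x) = b; last by split.
apply: sup_sublevel_root => // [y z y0 yz|]; last by rewrite curvatureE.
rewrite !curvatureE ?(lt_trans y0 yz)//.
by apply: lt_pattern_curvature => //; exact: ltW.
Qed.

Let acrit_attained : exists p : G, acrit R G = vertex_acrit R (vertex_of p) /\
  forall x : G, acrit R G <= vertex_acrit R (vertex_of x).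
Proof.
have /card_gt0P[x0 _] := dart_gt0 G.
have [p _ pmin] := @arg_minP _ _ _ x0 predT (fun x => vertex_acrit R (vertex_of x)) isT.
have e : acrit R G = vertex_acrit R (vertex_of p).
  apply: inf_min; first by exists (vertex_of p) => //=; exact: vertex_of_in.
  by move=> _ [v /= /imsetP[x _ ->] <-]; exact: pmin.
by exists p; split=> // x; rewrite e; exact: pmin.
Qed.

Lemma area_cri_le : ~ hyperbolic_tiling R G 2 -> area_cri R G <= 4 * pi - 10^-1 ^+ 7.
Proof.
move=> notile; have [p [pE pmin]] := acrit_attained; rewrite /area_cri.
have a0 : 0 < acrit R G by rewrite pE; case: (vertex_acritP p).
have Kp : pattern_curvature (acrit R G) (pattern p) = 0.
  by rewrite pE; case: (vertex_acritP p).
have K_le0 x : pattern_curvature (acrit R G) (pattern x) <= 0.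
  have [_ <-] := vertex_acritP x.
  by apply: le_pattern_curvature; rewrite ?pattern_ge3 ?pmin// ltW.
move: (acrit R G) a0 Kp K_le0 => a a0 Kp K_le0 {pE pmin}.
have defect x := pattern_defect a0 (K_le0 x).
have [/existsP[x /andP[/eqP Kx Kex]]|] := boolP [exists x,
    (pattern_curvature a (pattern x) == 0) &&
    (pattern_curvature a (pattern (edge G x)) != 0)]; last first.
  (* If no edge leads from zero to nonzero curvature, connectedness spreads zero curvature from [p]
     to all vertices, and the common side length gives a tiling. *)
  rewrite negb_exists => /forallP noedge; case: notile; split=> //.
  have K0 x : pattern_curvature a (pattern x) == 0.
    apply: (cmap_connected_ind (P := fun x => pattern_curvature a (pattern x) == 0)
      (x0 := p)) => [|y Ky|y]; first exact/eqP.
      by have := noedge y; rewrite Ky/= negbK.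
    by rewrite -!curvatureE// vertex_of_node.
  exists (fun=> a); split=> // v /imsetP[x _ ->].
  have := K0 x; rewrite -curvatureE// subr_eq0 => /eqP->.
  by [].
have Kex_lt0 : pattern_curvature a (pattern (edge G x)) < 0.
  by rewrite lt_neqAle Kex K_le0.
have patE : pattern (edge G x) =
    [:: d (node G x); d x; d (node G (node G (edge G x)))].
  by rewrite /pattern !d_node edgeK.
have gap : pattern_curvature a (pattern (edge G x)) <= - 10^-1 ^+ 7.
  rewrite patE; apply: (curvature_gap _ _ _ _ _ Kx); rewrite ?d_ge3//; last first.
    exact: face_deg_le.
  (* A third face of no larger degree would have no larger angle, and the curvature at the far end
     would not be negative. *)
  rewrite ltnNge; apply/negP => /(le_asin_ratio_deg a (d_ge3 _)).
  move: Kex_lt0 Kx; rewrite patE /pattern !pattern_curvature_cons pattern_curvature_nil.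
  lra.
(* One vertex contributes the gap, all others at most 0. *)
apply: le_trans (surface_area_le a0) _; rewrite lerD2l.
rewrite (bigD1 (vertex_of (edge G x))) ?vertex_of_in//=.
rewrite curvatureE// -[leRHS]addr0 lerD//.
apply: sumr_le0 => v /andP[/imsetP[y _ ->] _].
by rewrite curvatureE.
Qed.

End CubicSurface.

(** * Rational enclosures *)

Section RationalEnclosures.
Variable R : realType.
Implicit Types (x y : R) (l u : QArith_base.Q).

(** Binary integers and rationals let the numerical side conditions be decided by evaluation; [ZR]
    and [QR] carry them into the reals. *)
Definition ZR (z : Z) : R := (int_of_Z z)%:~R.
Definition QR (q : QArith_base.Q) : R := ZR (QArith_base.Qnum q) / ZR (Zpos (QArith_base.Qden q)).

Lemma ZR_ge0 z : BinInt.Z.le Z0 z -> 0 <= ZR z.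
Proof. by case: z => [|p|p] // _; rewrite /ZR ler0z. Qed.

Lemma ZR_gt0 p : 0 < ZR (Zpos p).
Proof. by rewrite /ZR ltr0z; rewrite /int_of_Z ltz_nat; apply/ssrnat.ltP; lia. Qed.

Lemma ZR_mul (a b : Z) : ZR (BinInt.Z.mul a b) = ZR a * ZR b.
Proof. by rewrite /ZR (rmorphM int_of_Z) intrM. Qed.

Lemma ZR_add (a b : Z) : ZR (BinInt.Z.add a b) = ZR a + ZR b.
Proof. by rewrite /ZR (raddfD int_of_Z) intrD. Qed.

Lemma ZR_opp (a : Z) : ZR (BinInt.Z.opp a) = - ZR a.
Proof. by rewrite /ZR (raddfN int_of_Z) intrN. Qed.

Lemma QR_add p q : QR (QArith_base.Qplus p q) = QR p + QR q.
Proof.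
case: p q => [a b] [c d]; rewrite /QR /= BinInt.Pos2Z.inj_mul ZR_add !ZR_mul.
by field; rewrite !gt_eqF// ZR_gt0.
Qed.

Lemma QR_mul p q : QR (QArith_base.Qmult p q) = QR p * QR q.
Proof.
case: p q => [a b] [c d]; rewrite /QR /= BinInt.Pos2Z.inj_mul !ZR_mul.
by field; rewrite !gt_eqF// ZR_gt0.
Qed.

Lemma QR_opp p : QR (QArith_base.Qopp p) = - QR p.
Proof. by case: p => a b; rewrite /QR /= ZR_opp mulNr. Qed.

Lemma QR_le p q : QArith_base.Qle_bool p q -> QR p <= QR q.
Proof.
case: p q => [a b] [c d] /QArith_base.Qle_bool_iff; rewrite /QArith_base.Qle /QR /= => h.
rewrite ler_pdivrMr ?ZR_gt0// mulrAC ler_pdivlMr ?ZR_gt0// -!ZR_mul.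
rewrite -subr_ge0 -ZR_opp -ZR_add; apply: ZR_ge0.
exact: Zorder.Zle_minus_le_0.
Qed.

Lemma QR_lt p q : ~~ QArith_base.Qle_bool q p -> QR p < QR q.
Proof.
case: p q => [a b] [c d] h.
rewrite /QR /= ltr_pdivrMr ?ZR_gt0// mulrAC ltr_pdivlMr ?ZR_gt0// -!ZR_mul.
rewrite -subr_gt0 -ZR_opp -ZR_add.
have : BinInt.Z.lt Z0 (BinInt.Z.add (BinInt.Z.mul c (Zpos b))
    (BinInt.Z.opp (BinInt.Z.mul a (Zpos d)))).
  have : ~ BinInt.Z.le (BinInt.Z.mul c (Zpos b)) (BinInt.Z.mul a (Zpos d)).
    by move=> hle; move/negP: h; apply; apply/QArith_base.Qle_bool_iff.
  by lia.
by case: BinInt.Z.add => // p _; exact: ZR_gt0.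
Qed.

Definition enclosed l u x := QR l <= x <= QR u.

Local Notation "p <=? q" := (QArith_base.Qle_bool p q).
Local Notation "p *q q" := (QArith_base.Qmult p q) (at level 40).
Local Notation q0 := (QArith_base.Qmake Z0 1).
Local Notation q1 := (QArith_base.Qmake (Zpos 1) 1).

Lemma QR0 : QR q0 = 0.
Proof. by rewrite /QR /ZR mul0r. Qed.

Lemma QR1 : QR q1 = 1.
Proof. by rewrite /QR /ZR divr1. Qed.

Lemma QR_pos p : QR (QArith_base.Qmake (Zpos p) 1) = (BinPos.Pos.to_nat p)%:R.
Proof. by rewrite /QR /ZR divr1. Qed.

Lemma QR_inv_pos p : QR (QArith_base.Qmake (Zpos 1) p) = (BinPos.Pos.to_nat p)%:R^-1.
Proof. by rewrite /QR /ZR div1r. Qed.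

Lemma QR_exp q n : QR (iter n (QArith_base.Qmult q) q1) = QR q ^+ n.
Proof. by elim: n => [|n IHn]; rewrite ?QR1 ?expr0 //= QR_mul IHn exprS. Qed.

Lemma QR_eq p q : (p <=? q) && (q <=? p) -> QR p = QR q.
Proof. by move=> /andP[/QR_le pq /QR_le qp]; apply/eqP; rewrite eq_le pq. Qed.

(** In this rule and the next ones the target interval is chosen freely and only checked by a
    boolean test, so results can be rounded outwards to a fixed denominator. *)
Lemma enclosed_mul l1 u1 l2 u2 l u x y :
  enclosed l1 u1 x -> enclosed l2 u2 y ->
  [&& q0 <=? l1, q0 <=? l2, l <=? l1 *q l2 & u1 *q u2 <=? u] ->
  enclosed l u (x * y).
Proof.
move=> /andP[lx xu] /andP[ly yu] /and4P[/QR_le + /QR_le + /QR_le + /QR_le].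
rewrite !QR_mul QR0 => l10 l20 hl hu; apply/andP; split.
  by apply: le_trans hl _; exact: ler_pM.
by apply: le_trans hu; apply: ler_pM => //; [exact: le_trans lx|exact: le_trans ly].
Qed.

Lemma enclosed_add l1 u1 l2 u2 l u x y :
  enclosed l1 u1 x -> enclosed l2 u2 y ->
  (l <=? QArith_base.Qplus l1 l2) && (QArith_base.Qplus u1 u2 <=? u) ->
  enclosed l u (x + y).
Proof.
move=> /andP[lx xu] /andP[ly yu] /andP[/QR_le + /QR_le].
by rewrite !QR_add => hl hu; apply/andP; split; lra.
Qed.

Lemma enclosed_sub l1 u1 l2 u2 l u x y :
  enclosed l1 u1 x -> enclosed l2 u2 y ->
  (l <=? QArith_base.Qminus l1 u2) && (QArith_base.Qminus u1 l2 <=? u) ->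
  enclosed l u (x - y).
Proof.
move=> /andP[lx xu] /andP[ly yu] /andP[/QR_le + /QR_le].
by rewrite !QR_add !QR_opp => hl hu; apply/andP; split; lra.
Qed.

Lemma enclosed_div l1 u1 l2 u2 l u x y : 0 < y ->
  enclosed l1 u1 x -> enclosed l2 u2 y ->
  [&& q0 <=? l, q0 <=? u, l *q u2 <=? l1 & u1 <=? u *q l2] ->
  enclosed l u (x / y).
Proof.
move=> y0 /andP[lx xu] /andP[ly yu] /and4P[/QR_le + /QR_le + /QR_le + /QR_le].
rewrite !QR_mul QR0 => l0 u0 hl hu; apply/andP; split.
  by rewrite ler_pdivlMr// (le_trans _ lx)// (le_trans _ hl)// ler_wpM2l.
by rewrite ler_pdivrMr// (le_trans xu)// (le_trans hu)// ler_wpM2l.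
Qed.

(** A square root is certified by comparing squares of its proposed bounds. *)
Lemma enclosed_pythagorean l1 u1 l u x y : 0 <= y -> x ^+ 2 + y ^+ 2 = 1 ->
  enclosed l1 u1 x ->
  [&& q0 <=? l1, q0 <=? l, q0 <=? u,
    QArith_base.Qplus (l *q l) (u1 *q u1) <=? q1 &
    q1 <=? QArith_base.Qplus (u *q u) (l1 *q l1)] ->
  enclosed l u y.
Proof.
move=> y0 xy /andP[lx xu] /and5P[/QR_le + /QR_le + /QR_le + /QR_le + /QR_le].
rewrite !QR_add !QR_mul QR0 QR1 => l10 l0 u0 hl hu.
have x0 : 0 <= x by exact: le_trans lx.
apply/andP; split; rewrite -(@ler_pXn2r _ 2%N) ?nnegrE//.
  have : x ^+ 2 <= QR u1 ^+ 2 by rewrite ler_pXn2r ?nnegrE ?(le_trans x0).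
  by rewrite !expr2 in xy *; lra.
have : QR l1 ^+ 2 <= x ^+ 2 by rewrite ler_pXn2r ?nnegrE.
by rewrite !expr2 in xy *; lra.
Qed.

Lemma enclosed01 l u x : enclosed l u x -> (q0 <=? l) && (u <=? q1) -> 0 <= x <= 1.
Proof.
move=> /andP[lx xu] /andP[/QR_le + /QR_le]; rewrite QR0 QR1 => l0 u1.
by rewrite (le_trans l0)// (le_trans xu).
Qed.

Lemma enclosed_gt0 l u x : enclosed l u x -> ~~ (l <=? q0) -> 0 < x.
Proof. by move=> /andP[lx _] /QR_lt; rewrite QR0 => /lt_le_trans; apply. Qed.

Lemma enclosed_lt1 l u x : enclosed l u x -> ~~ (q1 <=? u) -> x < 1.
Proof. by move=> /andP[_ xu] /QR_lt; rewrite QR1; exact: le_lt_trans. Qed.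

Lemma sqrt_pythagorean x : 0 <= x <= 1 -> x ^+ 2 + Num.sqrt (1 - x ^+ 2) ^+ 2 = 1.
Proof.
move=> /andP[x0 x1]; rewrite sqr_sqrtr ?subrKC//.
by rewrite subr_ge0 -[leRHS](expr1n _ 2) ler_pXn2r ?nnegrE.
Qed.

(* The Taylor polynomial of cos in y = x ^ 2, in Horner form; k counts the
   terms already factored out. *)
Fixpoint cos_horner n k (y : R) : R := if n is m.+1 then
  1 - y / (k.*2.+1%:R * k.*2.+2%:R) * cos_horner m k.+1 y else 0.

Lemma cos_hornerE n k y : cos_horner n k y =
  \sum_(j < n) (-1) ^+ j * y ^+ j * (k.*2`!%:R / (k + j).*2`!%:R).
Proof.
elim: n k => [|n IHn] k /=; first by rewrite big_ord0.
rewrite IHn big_ord_recl addn0 !expr0 !mul1r divff ?pnatr_eq0 -?lt0n ?fact_gt0//.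
congr (_ + _); rewrite mulr_sumr -sumrN; apply: eq_bigr => j _.
rewrite /bump/= ?add1n addSnnS !exprS doubleS 2!factS !natrM.
have h1 : k.*2.+1%:R != 0 :> R by rewrite pnatr_eq0.
have h2 : k.*2.+2%:R != 0 :> R by rewrite pnatr_eq0.
have h3 : (k + j.+1).*2`!%:R != 0 :> R by rewrite pnatr_eq0 -lt0n fact_gt0.
move: (k.*2.+1%:R : R) (k.*2.+2%:R : R) ((k + j.+1).*2`!%:R : R) h1 h2 h3.
by move=> u v w h1 h2 h3; field; rewrite h1 h2 h3.
Qed.

Lemma cos_partial_horner n x : cos_partial n x = cos_horner n 0 (x ^+ 2).
Proof.
rewrite cos_hornerE; apply: eq_bigr => j _.
by rewrite -mulrA add0n fact0 mul1r -exprM mul2n.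
Qed.

Lemma QR_inv_nat m : (0 < m)%N -> QR (QArith_base.Qmake (Zpos 1) (BinPos.Pos.of_nat m)) = m%:R^-1.
Proof.
move=> m0; have e : int_of_Z (Zpos (BinPos.Pos.of_nat m)) = Posz m.
  by rewrite /= Pnat.Nat2Pos.id//; lia.
by rewrite /QR /ZR [QArith_base.Qden _]/= e [int_of_Z _]/= div1r.
Qed.

Fixpoint cos_hornerQ n k (y : QArith_base.Q) : QArith_base.Q :=
  if n is m.+1 then QArith_base.Qminus q1
    ((y *q QArith_base.Qmake (Zpos 1) (BinPos.Pos.of_nat (k.*2.+1 * k.*2.+2))) *q
    cos_hornerQ m k.+1 y) else q0.

Lemma QR_cos_horner n k (q : QArith_base.Q) : QR (cos_hornerQ n k q) = cos_horner n k (QR q).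
Proof.
elim: n k => [|n IHn] k; first exact: QR0.
rewrite [cos_hornerQ]lock /= -lock.
have -> : cos_hornerQ n.+1 k q = QArith_base.Qminus q1
    ((q *q QArith_base.Qmake (Zpos 1) (BinPos.Pos.of_nat (k.*2.+1 * k.*2.+2))) *q
    cos_hornerQ n k.+1 q) by [].
by rewrite QR_add QR_opp QR1 !QR_mul IHn QR_inv_nat// natrM.
Qed.

Lemma cos_partialQ n q : cos_partial n (QR q) = QR (cos_hornerQ n 0 (q *q q)).
Proof. by rewrite cos_partial_horner QR_cos_horner QR_mul expr2. Qed.

(** An even number of Taylor terms bounds cos from below, so cos q >= 0; as q <= 2 <= pi and cos
    decreases on [0, pi], q cannot exceed pi / 2. *)
Lemma pi_ge_of_cos q n : odd n ->
  [&& q0 <=? q, q <=? QArith_base.Qmake (Zpos 2) 1 & q0 <=? cos_hornerQ n.+1 0 (q *q q)] ->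
  2 * QR q <= pi.
Proof.
move=> no /and3P[/QR_le + /QR_le + /QR_le]; rewrite QR0 -cos_partialQ => x0 x2 hc.
have [p2 _] := pi_bounds R.
have cx := le_trans hc (cos_partial_ge x0 (n := n) _).
have q2 : QR (QArith_base.Qmake (Zpos 2) 1) = 2 by rewrite /QR /ZR /= divr1.
rewrite -ler_pdivlMl// leNgt; apply/negP => hx.
have : cos (QR q) < cos (2^-1 * pi).
  by rewrite ltr_cos// in_itv/=; apply/andP; split; rewrite ?q2 in x2; lra.
by rewrite mulrC cos_pihalf ltNge cx//= no.
Qed.

Lemma pi_le_of_cos q n : ~~ odd n ->
  (q0 <=? q) && (cos_hornerQ n.+1 0 (q *q q) <=? q0) ->
  pi <= 2 * QR q.
Proof.
move=> no /andP[/QR_le + /QR_le]; rewrite QR0 -cos_partialQ => x0 hc.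
have [p2 _] := pi_bounds R.
have cx := le_trans (cos_partial_le x0 (n := n) no) hc.
rewrite leNgt; apply/negP => hx.
have : 0 < cos (QR q) by apply: cos_gt0_pihalf; apply/andP; split; lra.
by rewrite ltNge cx.
Qed.

(** Cosine decreases on [0, pi]: the upper bound for pi with an even number of terms gives the lower
    bound, and the lower bound for pi with an odd number gives the upper one. *)
Lemma enclosed_cos_pidivn (pl pu l u : QArith_base.Q) (m n : nat) : (3 <= m)%N -> ~~ odd n ->
  enclosed pl pu pi ->
  let xl := pl *q QArith_base.Qmake (Zpos 1) (BinPos.Pos.of_nat m) in
  let xu := pu *q QArith_base.Qmake (Zpos 1) (BinPos.Pos.of_nat m) in
  [&& q0 <=? pl, pu <=? QArith_base.Qmake (Zpos 4) 1,
    l <=? cos_hornerQ n.+2 0 (xu *q xu) & cos_hornerQ n.+1 0 (xl *q xl) <=? u] ->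
  enclosed l u (cos (pi / m%:R)).
Proof.
move=> m3 no /andP[pl_le pu_ge] xl xu /and4P[/QR_le + /QR_le + /QR_le + /QR_le].
rewrite QR0 -!cos_partialQ => pl0 pu4 hl hu.
have m0 : (0 < m)%N by exact: leq_trans m3.
have mR : 0 < m%:R :> R by rewrite ltr0n.
have q4 : QR (QArith_base.Qmake (Zpos 4) 1) = 4 by rewrite /QR /ZR /= divr1.
have [p2 p4] := pi_bounds R.
have xlE : QR xl = QR pl / m%:R by rewrite QR_mul QR_inv_nat.
have xuE : QR xu = QR pu / m%:R by rewrite QR_mul QR_inv_nat.
have xl_le : QR xl <= pi / m%:R by rewrite xlE ler_pM2r ?invr_gt0.
have xu_ge : pi / m%:R <= QR xu by rewrite xuE ler_pM2r ?invr_gt0.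
have xl0 : 0 <= QR xl by rewrite xlE divr_ge0// ltW.
have /andP[h1 h2] := pidivn_bounds R m3.
have xu_lt : QR xu <= 2.
  rewrite xuE ler_pdivrMr// (le_trans pu4)// q4.
  have : 3 <= m%:R :> R by rewrite ler_nat.
  lra.
have p_in : pi / m%:R \in `[0, pi : R].
  by rewrite in_itv/=; move: (pi / m%:R) h1 h2 => x h1 h2; apply/andP; split; lra.
have xl_in : QR xl \in `[0, pi : R].
  by rewrite in_itv/= xl0 (le_trans xl_le)//; move: p_in; rewrite in_itv => /andP[].
have xu_in : QR xu \in `[0, pi : R].
  by rewrite in_itv/=; apply/andP; split; [rewrite (le_trans (ltW h1))|exact: le_trans p2].
apply/andP; split.
  apply: (le_trans hl); apply: (le_trans (cos_partial_ge (n := n.+1) _ _)).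
  - by rewrite (le_trans (ltW h1)).
  - by rewrite /= negbK.
  - by rewrite leNgt ltr_cos// -leNgt.
apply: le_trans hu; apply: (le_trans _ (cos_partial_le (n := n) _ _)) => //.
by rewrite leNgt ltr_cos// -leNgt.
Qed.

End RationalEnclosures.

(** * The leading digits of kappa *)

Section Kappa.
Variable R : realType.

(** Decimals and error margins are integers in units of 10 ^ -30. *)
Local Notation dec z := (QArith_base.Qmake z (BinPos.Pos.pow 10 30)).
Local Notation "x =~ z +- e" :=
  (enclosed (dec (BinInt.Z.sub z e)) (dec (BinInt.Z.add z e)) x)
  (at level 70, z at next level, e at next level).

Lemma pi_enclosed :
  enclosed (dec 3141592653589793238462643383279)
           (dec 3141592653589793238462643383280) (pi : R).
Proof.
have q2 : QR R (QArith_base.Qmake (Zpos 2) 1) = 2 by rewrite /QR /ZR /= divr1.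
apply/andP; split.
  apply: le_trans (@pi_ge_of_cos R (QArith_base.Qmake 3141592653589793238462643383279
    (BinPos.Pos.mul 2 (BinPos.Pos.pow 10 30))) 21 isT _); last by vm_compute.
  by rewrite -q2 -QR_mul; apply: QR_le; vm_compute.
apply: le_trans (@pi_le_of_cos R (QArith_base.Qmake 3141592653589793238462643383280
  (BinPos.Pos.mul 2 (BinPos.Pos.pow 10 30))) 20 isT _) _; first by vm_compute.
by rewrite -q2 -QR_mul; apply: QR_le; vm_compute.
Qed.

Lemma cos29_enclosed : (cos (pi / 29%:R) : R) =~ 994137957154359608955302715879 +- 3.
Proof. by apply: (@enclosed_cos_pidivn R _ _ _ _ 29 10 isT isT pi_enclosed); vm_compute. Qed.

Lemma cos55_enclosed : (cos (pi / 55%:R) : R) =~ 998369103926135679101288025498 +- 3.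
Proof. by apply: (@enclosed_cos_pidivn R _ _ _ _ 55 10 isT isT pi_enclosed); vm_compute. Qed.

Lemma cos32_enclosed : (cos (pi / 32%:R) : R) =~ 995184726672196886244836953109 +- 3.
Proof. by apply: (@enclosed_cos_pidivn R _ _ _ _ 32 10 isT isT pi_enclosed); vm_compute. Qed.

Lemma cos43_enclosed : (cos (pi / 43%:R) : R) =~ 997332283663551672805860611589 +- 3.
Proof. by apply: (@enclosed_cos_pidivn R _ _ _ _ 43 10 isT isT pi_enclosed); vm_compute. Qed.

(* k, sB are the cosine and the sine of half the angle of the 55-gon at the
   critical side length a, s = 1 / cosh (a / 2), and sE, cE, sF, cF are the sines
   and cosines of the half-angles of the 32-gon and the 43-gon. *)
Let c29 : R := cos (pi / 29%:R).
Let c55 : R := cos (pi / 55%:R).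
Let k : R := c29 / (c55 + c55).
Let sB := Num.sqrt (1 - k ^+ 2).
Let s := sB / c55.
Let sE := s * cos (pi / 32%:R).
Let sF := s * cos (pi / 43%:R).
Let cE := Num.sqrt (1 - sE ^+ 2).
Let cF := Num.sqrt (1 - sF ^+ 2).

Let c55_gt0 : 0 < c55. Proof. exact: cos_pidivn_gt0. Qed.

Let k_enclosed : k =~ 497880970697542183022739881584 +- 20.
Proof.
apply: (@enclosed_div R _ _ (dec 1996738207852271358202576050980)
  (dec 1996738207852271358202576051010) _ _ _ _ _ cos29_enclosed).
- by rewrite addr_gt0.
- by apply: (enclosed_add cos55_enclosed cos55_enclosed); vm_compute.
- by vm_compute.
Qed.

Let k01 : 0 <= k <= 1.
Proof. by apply: enclosed01 k_enclosed _; vm_compute. Qed.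

Let sB_enclosed : sB =~ 867245374168852596316279212011 +- 40.
Proof.
apply: (enclosed_pythagorean (sqrtr_ge0 _) (sqrt_pythagorean k01) k_enclosed).
by vm_compute.
Qed.

Let s_enclosed : s =~ 868662071731153782113803388093 +- 80.
Proof. by apply: (enclosed_div c55_gt0 sB_enclosed cos55_enclosed); vm_compute. Qed.

Let sE_enclosed : sE =~ 864479226426272562133459902046 +- 120.
Proof. by apply: (enclosed_mul s_enclosed cos32_enclosed); vm_compute. Qed.

Let sF_enclosed : sF =~ 866344727731543534539855673861 +- 120.
Proof. by apply: (enclosed_mul s_enclosed cos43_enclosed); vm_compute. Qed.

Let sE01 : 0 <= sE <= 1.
Proof. by apply: enclosed01 sE_enclosed _; vm_compute. Qed.

Let sF01 : 0 <= sF <= 1.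
Proof. by apply: enclosed01 sF_enclosed _; vm_compute. Qed.

Let cE_enclosed : cE =~ 502668545939999486916723641144 +- 400.
Proof.
apply: (enclosed_pythagorean (sqrtr_ge0 _) (sqrt_pythagorean sE01) sE_enclosed).
by vm_compute.
Qed.

Let cF_enclosed : cF =~ 499446506376566521504456218153 +- 400.
Proof.
apply: (enclosed_pythagorean (sqrtr_ge0 _) (sqrt_pythagorean sF01) sF_enclosed).
by vm_compute.
Qed.

(** The expression is sin (- kappa / 2), by the addition formulas applied to three half-angles minus
    pi. Two products agreeing in nine digits cancel, so the factors are kept to almost 30 digits. *)
Let sum_enclosed :
  (sB * (sE * sF - cE * cF) - k * (sE * cF + cE * sF)) =~ 248119996382096204820 +- 10000.
Proof.
have sEsF : (sE * sF) =~ 748937020047844477305258492275 +- 1000.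
  by apply: (enclosed_mul sE_enclosed sF_enclosed); vm_compute.
have cEcF : (cE * cF) =~ 251056049135121375196678890736 +- 1000.
  by apply: (enclosed_mul cE_enclosed cF_enclosed); vm_compute.
have sEcF : (sE * cF) =~ 431761129473718632969429096723 +- 1000.
  by apply: (enclosed_mul sE_enclosed cF_enclosed); vm_compute.
have cEsF : (cE * sF) =~ 435484244571599738671966057836 +- 1000.
  by apply: (enclosed_mul cE_enclosed sF_enclosed); vm_compute.
have hA : (sE * sF - cE * cF) =~ 497880970912723102108579601538 +- 3000.
  by apply: (enclosed_sub sEsF cEcF); vm_compute.
have hB : (sE * cF + cE * sF) =~ 867245374045318371641395154560 +- 3000.
  by apply: (enclosed_add sEcF cEsF); vm_compute.
have hsA : (sB * (sE * sF - cE * cF)) =~ 431784968910756162641678491521 +- 4000.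
  by apply: (enclosed_mul sB_enclosed hA); vm_compute.
have hkB : (k * (sE * cF + cE * sF)) =~ 431784968662636166259582286700 +- 4000.
  by apply: (enclosed_mul k_enclosed hB); vm_compute.
by apply: (enclosed_sub hsA hkB); vm_compute.
Qed.

Let asinP (x : R) : 0 <= x <= 1 -> [/\ 0 <= asin x <= pi / 2, sin (asin x) = x &
  cos (asin x) = Num.sqrt (1 - x ^+ 2)].
Proof.
move=> /andP[x0 x1]; have h : -1 <= x <= 1 by rewrite x1 andbT; lra.
split; [|by rewrite asinK// in_itv|exact: cos_asin].
by rewrite asin_ge0 ?asin_lepi2 ?x0.
Qed.

Let B_P : [/\ 0 <= asin sB <= pi / 2, sin (asin sB) = sB & cos (asin sB) = k].
Proof.
have sB01 : 0 <= sB <= 1 by apply: enclosed01 sB_enclosed _; vm_compute.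
have [hB sinB cosB] := asinP sB01; split=> //.
rewrite cosB /sB sqr_sqrtr ?subKr ?sqrtr_sqr ?ger0_norm//; first by case/andP: k01.
by have := sqrt_pythagorean k01; have := sqr_ge0 (Num.sqrt (1 - k ^+ 2)); lra.
Qed.

(** With B = asin sB one has c55 * s = sin B and c29 * s = 2 k c55 s = 2 cos B sin B = sin (pi - 2
    B), so the half-angles B, B and pi - 2 B sum to pi. *)
Lemma pattern_acrit_29_55_55 : exists2 a : R, 0 < a &
  pattern_acrit R [:: 29; 55; 55]%N = a /\ (cosh (a / 2))^-1 = s.
Proof.
have s0 : 0 < s by apply: enclosed_gt0 s_enclosed _; vm_compute.
have s01 : 0 <= s <= 1 by apply: enclosed01 s_enclosed _; vm_compute.
have s_lt1 : s < 1 by apply: enclosed_lt1 s_enclosed _; vm_compute.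
have sV1 : 1 <= s^-1 by rewrite invf_ge1// ltW.
have [b b0 hb] := cosh_surj sV1.
have {}b0 : 0 < b.
  rewrite lt_neqAle b0 andbT; apply/eqP => b00.
  by move: hb; rewrite -b00 cosh0 => /esym/eqP; rewrite invr_eq1 lt_eqF.
have ba : 2 * b / 2 = b by field.
have a0 : 0 < 2 * b by rewrite mulr_gt0.
exists (2 * b) => //; split; last by rewrite ba hb invrK.
apply: pattern_acritP => //.
rewrite !pattern_curvature_cons pattern_curvature_nil ba hb invrK -/c29 -/c55.
have sBE : c55 * s = sB by rewrite /s mulrC divfK ?gt_eqF.
have kE : 2 * k * c55 = c29.
  by rewrite /k; field; rewrite -mulr2n mulrn_eq0/= gt_eqF.
rewrite sBE.
have [/andP[B0 B1] snB csB] := B_P.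
have k_half : k ^+ 2 < 1 / 2.
  have /andP[k0 _] := k01.
  have : k < 1 / 2.
    have /andP[_ ku] := k_enclosed; apply: le_lt_trans ku _.
    have -> : 1 / 2 = QR R (QArith_base.Qmake (Zpos 1) 2) by [].
    by apply: QR_lt; vm_compute.
  by rewrite expr2; nra.
have p0 := @pi_gt0 R.
(* This puts pi - 2 B in the range of [asin]; it holds because cos (2 B) = 2 k ^ 2 - 1 is
   negative. *)
have B2 : pi / 4 <= asin sB.
  rewrite leNgt; apply/negP => hB.
  have : 0 <= cos (asin sB *+ 2).
    by apply: cos_ge0_pihalf; rewrite -mulr_natr; apply/andP; split; lra.
  by rewrite cos_mulr2n csB -mulr_natr; lra.
have -> : c29 * s = sin (pi - asin sB *+ 2).
  rewrite [in RHS]sinD sinN cosN sinpi cospi sin_mulr2n csB snB -kE -sBE.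
  by ring.
rewrite sinK; last by rewrite in_itv/= -mulr_natr; apply/andP; split; lra.
by rewrite -mulr_natr; ring.
Qed.

Let half_lower : ((496 * 10 ^+ 3 + 239) / 10 ^+ 15) / 2 =
  QR R (QArith_base.Qmake 496239 (BinPos.Pos.mul 2 (BinPos.Pos.pow 10 15))).
Proof.
rewrite -exprVn -(QR_inv_pos R 10) -(QR_inv_pos R 2) -(QR_pos R 496) -(QR_pos R 239).
rewrite -(QR_pos R 10) -!QR_exp -!(QR_mul, QR_add).
by apply: QR_eq; vm_compute.
Qed.

Let half_upper : ((496 * 10 ^+ 3 + 240) / 10 ^+ 15) / 2 =
  QR R (QArith_base.Qmake 496240 (BinPos.Pos.mul 2 (BinPos.Pos.pow 10 15))).
Proof.
rewrite -exprVn -(QR_inv_pos R 10) -(QR_inv_pos R 2) -(QR_pos R 496) -(QR_pos R 240).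
rewrite -(QR_pos R 10) -!QR_exp -!(QR_mul, QR_add).
by apply: QR_eq; vm_compute.
Qed.

(** The bounds are halved, as kappa = - 2 x with sin x the enclosed value y. They are shaped for sin
    x <= x and u - u ^ 3 / 6 <= sin u, which give l <= x < u. *)
Let sum_bounds (y := sB * (sE * sF - cE * cF) - k * (sE * cF + cE * sF))
    (l := (496 * 10 ^+ 3 + 239) / 10 ^+ 15 / 2 : R)
    (u := (496 * 10 ^+ 3 + 240) / 10 ^+ 15 / 2 : R) :
  [/\ 0 < y, l <= y, y < u - u ^+ 3 / 6 & 0 < u <= 1].
Proof.
have /andP[yl yu] := sum_enclosed; split.
- by apply: lt_le_trans yl; rewrite -(QR0 R); apply: QR_lt; vm_compute.
- by apply: le_trans yl; rewrite /l half_lower; apply: QR_le; vm_compute.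
- apply: le_lt_trans yu _; rewrite /u half_upper -(QR_inv_pos R 6) -QR_exp.
  by rewrite -QR_mul -QR_opp -QR_add; apply: QR_lt; vm_compute.
- rewrite /u half_upper; apply/andP; split.
    by rewrite -(QR0 R); apply: QR_lt; vm_compute.
  by rewrite -(QR1 R); apply: QR_le; vm_compute.
Qed.

Lemma kappa_bounds :
  let kappa : R :=
    pattern_curvature (pattern_acrit R [:: 29; 55; 55]%N) [:: 32; 43; 55]%N in
  - ((496 * 10 ^+ 3 + 240) / 10 ^+ 15) < kappa
    <= - ((496 * 10 ^+ 3 + 239) / 10 ^+ 15).
Proof.
have [a a0 [-> ha]] := pattern_acrit_29_55_55.
rewrite !pattern_curvature_cons pattern_curvature_nil ha.
rewrite (mulrC (cos (pi / 32%:R)) s) (mulrC (cos (pi / 43%:R)) s) -/sF -/sE -/c55.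
have -> : c55 * s = sB by rewrite /s mulrC divfK ?gt_eqF.
have [/andP[B0 B1] snB csB] := B_P.
have [/andP[E0 E1] snE csE] := asinP sE01.
have [/andP[F0 F1] snF csF] := asinP sF01.
have p0 := @pi_gt0 R; have [p2 _] := pi_bounds R.
set x := asin sB + (asin sE + asin sF) - pi.
have -> : 2 * pi - 2 * asin sB - 2 * asin sF - 2 * asin sE = - (2 * x).
  by rewrite /x; ring.
have sinx : sin x = sB * (sE * sF - cE * cF) - k * (sE * cF + cE * sF).
  rewrite /x sinB sinpi cospi mulr0 subr0 sinD sinD cosD snB csB snE csE snF csF -/cE -/cF.
  by ring.
have half (y : R) : y = 2 * (y / 2) by field.
have := sum_bounds; rewrite -sinx /=.
rewrite [X in - X < _]half [X in _ <= - X]half.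
set l := _ / 2; set u := _ / 2; move=> [X0 lX Xu /andP[u0 u1]].
move: l u lX Xu u0 u1 => l u lX Xu u0 u1; clear sinx.
(* The sum [x + pi] of the half-angles is nonnegative; if it were at most pi, then sin x = - sin (x
   + pi) would not be positive. *)
have x_gt0 : 0 < x.
  rewrite ltNge; apply/negP => x_le0.
  have : 0 <= sin (x + pi) by apply: sin_ge0_pi; rewrite /x in x_le0 *; apply/andP; split; lra.
  by rewrite sinDpi; lra.
have x_le : x <= pi / 2 by rewrite /x; lra.
have lx : l <= x by exact: le_trans lX (sin_le (ltW x_gt0)).
have xu : x < u.
  rewrite ltNge; apply/negP => ux.
  have u_in : u \in `[- (pi / 2), pi / 2] by rewrite in_itv/=; apply/andP; split; lra.
  have x_in : x \in `[- (pi / 2), pi / 2].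
    by rewrite in_itv/= x_le andbT (le_trans _ (ltW x_gt0))// oppr_le0 divr_ge0// ltW.
  have : sin u <= sin x by rewrite leNgt ltr_sin// -leNgt.
  by have := sin_ge (ltW u0); lra.
by apply/andP; split; [rewrite ltrN2|rewrite lerN2]; lra.
Qed.

End Kappa.

(** * The bound on the supremum of the critical areas *)

Theorem theorem9 (R : realType) :
  let kappa : R :=
    pattern_curvature (pattern_acrit R [:: 29; 55; 55]%N) [:: 32; 43; 55]%N in
  - ((496 * 10 ^+ 3 + 240) / 10 ^+ 15) < kappa
    <= - ((496 * 10 ^+ 3 + 239) / 10 ^+ 15) /\
  (sup_area_cri R 2 3 <= (4 * pi + kappa)%:E)%E.
Proof.
move=> kappa; have kb := kappa_bounds R; split=> //.
apply: ge_ereal_sup => _ [G [[spG genus2 nonpos] notile deg3] ->].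
rewrite lee_fin (le_trans (area_cri_le spG genus2 deg3 nonpos notile))// lerD2l.
(* The lower bound on kappa, about -5 * 10 ^ -10, is far above -10 ^ -7. *)
have /andP[/ltW + _] := kb; apply: le_trans; rewrite lerN2 exprVn.
by rewrite ler_pdivrMr ?exprn_gt0// ler_pdivlMl ?exprn_gt0//; lra.
Qed.
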